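(* Let $d\ge1$ and let $\gamma<2$ be a real number. Then there do not exist constants $c_1,c_2>0$ such that, with $$\beta(t)=\begin{cases} t^{2+\frac1d}, & 0<t\le 1,\\ t^2e^{-c_2t^{1/d}}, & t>1,\end{cases}$$ the inequality $$\|L_\Omega\|_{\mathrm{HS}}^2\le \|L_{\Omega^*}\|_{\mathrm{HS}}^2-c_1\,\beta(|\Omega|)\,\alpha[\Omega]^\gamma$$ holds for every measurable subset $\Omega\subset\mathbb{R}^{2d}$ of positive finite measure with $\alpha[\Omega]>0$.
   Context: $|\cdot|$ denotes Lebesgue measure on $\mathbb{R}^{2d}$. Let $\varphi(x)=2^{d/4}e^{-\pi|x|^2}$, $x\in\mathbb{R}^d$, and for $f\in L^2(\mathbb{R}^d)$ let $\mathcal{V}f(x,\omega)=\int_{\mathbb{R}^d}f(y)\overline{\varphi(y-x)}e^{-2\pi i\omega\cdot y}\,dy$, $(x,\omega)\in\mathbb{R}^d\times\mathbb{R}^d$, be the short-time Fourier transform with Gaussian window; $\mathcal{V}:L^2(\mathbb{R}^d)\to L^2(\mathbb{R}^{2d})$ is an isometry. For a measurable $\Omega\subset\mathbb{R}^{2d}$ of finite measure, the time-frequency localization operator is $L_\Omega=\mathcal{V}^*\chi_\Omega\mathcal{V}:L^2(\mathbb{R}^d)\to L^2(\mathbb{R}^d)$, i.e. $\langle L_\Omega f,g\rangle=\int_\Omega \mathcal{V}f(z)\overline{\mathcal{V}g(z)}\,dz$. $\|\cdot\|_{\mathrm{HS}}$ is the Hilbert-Schmidt norm. $\Omega^*$ is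 the open ball in $\mathbb{R}^{2d}$ centered at $0$ with $|\Omega^*|=|\Omega|$. The Fraenkel asymmetry index is $$\alpha[\Omega]=\inf\left\{\frac{|\Omega\triangle B|}{|\Omega|}: B\subset\mathbb{R}^{2d}\text{ is a ball of measure }|B|=|\Omega|\right\},$$ with $\Omega\triangle B=(\Omega\setminus B)\cup(B\setminus\Omega)$. *)

(* Defs.v *)
From HB Require Import structures.
From mathcomp Require Import all_boot all_order all_algebra.
From mathcomp Require Import all_classical all_reals all_analysis.
From mathcomp Require Import complex.
Set Implicit Arguments.
Unset Strict Implicit.
Unset Printing Implicit Defensive.
Import Order.TTheory GRing.Theory Num.Theory numFieldNormedType.Exports.
Local Open Scope classical_set_scope.
Local Open Scope ring_scope.

Section LebesgueMeasureTuple.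
Variable R : realType.

Definition consp n (p : measurableTypeR R * n.-tuple R) : n.+1.-tuple R :=
  [tuple of (p.1 : R) :: p.2].

Lemma measurable_consp n : measurable_fun setT (@consp n).
Proof.
have mf : measurable_fun setT
    (fun p : measurableTypeR R * n.-tuple R => (p.1 : R)).
  by move=> _ A mA; have := @measurable_fst _ _ (measurableTypeR R) (n.-tuple R)
    measurableT A mA.
exact: (measurable_cons mf measurable_snd).
Qed.

Section step.
Variables (n : nat) (m : {sigma_finite_measure set (n.-tuple R) -> \bar R}).

Definition leb_step : set (n.+1.-tuple R) -> \bar R :=
  pushforward (@lebesgue_measure R \x m)%E (@consp n).

Let leb_step0 : leb_step set0 = 0%E.
Proof. by rewrite /leb_step /pushforward preimage_set0 measure0. Qed.

Let mpre A : measurable A -> measurable ((@consp n) @^-1` A).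
Proof. by move=> mA; rewrite -[X in measurable X]setTI; exact: measurable_consp. Qed.

Let leb_step_ge0 A : (0 <= leb_step A)%E.
Proof. exact: (measure_ge0 (@lebesgue_measure R \x m)%E). Qed.

Let leb_step_sigma_additive : semi_sigma_additive leb_step.
Proof.
move=> F mF tF mUF; rewrite /leb_step /pushforward preimage_bigcup.
apply: measure_semi_sigma_additive.
- by move=> i; exact: mpre.
- apply/trivIsetP => /= i j _ _ ij; rewrite -preimage_setI.
  by move/trivIsetP : tF => /(_ _ _ _ _ ij) ->//; rewrite preimage_set0.
- by rewrite -preimage_bigcup; exact: mpre.
Qed.

HB.instance Definition _ := isMeasure.Build _ _ _ leb_step
  leb_step0 leb_step_ge0 leb_step_sigma_additive.

Let leb_step_sigma_finite : sigma_finite setT leb_step.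
Proof.
pose uncons (t : n.+1.-tuple R) : measurableTypeR R * n.-tuple R :=
  (tnth t ord0 : measurableTypeR R, [tuple of behead t]).
have muncons : measurable_fun setT uncons.
  apply: measurable_fun_pair; last exact: measurable_behead.
  by move=> _ A mA; exact: measurable_tnth.
have consK : cancel (@consp n) uncons.
  by move=> [x t]; congr pair; apply: val_inj.
have /sigma_finiteP[F [TF ndF Foo]] := sigma_finiteT (@lebesgue_measure R).
have /sigma_finiteP[G [TG ndG Goo]] := sigma_finiteT m.
exists (fun i => uncons @^-1` (F i `*` G i)) => [|i].
  rewrite -preimage_bigcup; apply/seteqP; split=> // t _.
  have [[i _ Fi] [j _ Gj]] : (\bigcup_i F i) (uncons t).1 /\
      (\bigcup_i G i) (uncons t).2 by rewrite -TF -TG.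
  exists (maxn i j) => //; split.
    by move: Fi; exact/subsetPset/ndF/leq_maxl.
  by move: Gj; exact/subsetPset/ndG/leq_maxr.
have [mF Fi] := Foo i; have [mG Gi] := Goo i; split.
  by rewrite -[X in measurable X]setTI; apply: muncons => //; exact: measurableX.
have -> : leb_step (uncons @^-1` (F i `*` G i)) =
    (@lebesgue_measure R \x m)%E (F i `*` G i).
  rewrite /leb_step /pushforward; congr (_ _); apply/funext => p.
  by rewrite -[LHS]/((F i `*` G i) (uncons (consp p))) consK.
by rewrite product_measure1E// lte_mul_pinfty// ge0_fin_numE.
Qed.

HB.instance Definition _ := Measure_isSigmaFinite.Build _ _ _ leb_step
  leb_step_sigma_finite.

End step.

(* Lebesgue measure on R^n, as the n-fold product of [lebesgue_measure]: the
   measurable sets of [n.-tuple R] are the Borel sets. *)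
Fixpoint leb n : {sigma_finite_measure set (n.-tuple R) -> \bar R} :=
  match n with
  | 0%N => dirac [tuple]
  | n'.+1 => leb_step (leb n')
  end.

End LebesgueMeasureTuple.

Section ComplexL2.
Context d (T : measurableType d) (R : realType).
Variable mu : {measure set T -> \bar R}.
Implicit Types f g : T -> R[i].

Definition cintegral f : R[i] :=
  Complex (\int[mu]_x complex.Re (f x)) (\int[mu]_x complex.Im (f x)).

Definition L2norm2 f : \bar R := (\int[mu]_x (Normc.normc (f x) ^+ 2)%:E)%E.

(* Members of L^2(mu) are represented by functions; all notions below are
   invariant under modification on a null set. *)
Definition L2 : set (T -> R[i]) :=
  [set f | [/\ measurable_fun setT (fun x => complex.Re (f x)),
               measurable_fun setT (fun x => complex.Im (f x)) &
               (L2norm2 f < +oo)%E]].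

Definition inner f g : R[i] := cintegral (fun x => f x * (g x)^*%C).

Definition orthonormal_basis (E : set (T -> R[i])) : Prop :=
  [/\ E `<=` L2,
      forall e, E e -> inner e e = 1,
      forall e e', E e -> E e' -> e <> e' -> inner e e' = 0 &
      forall f, L2 f -> (forall e, E e -> inner f e = 0) ->
        {ae mu, forall x, f x = 0}].

(* The sum of the ||A e||^2, e in E, is the same for all orthonormal bases E,
   so that the supremum is the common value. *)
Definition hs_norm2 (A : (T -> R[i]) -> (T -> R[i])) : \bar R :=
  ereal_sup [set \esum_(e in E) L2norm2 (A e) | E in orthonormal_basis].

End ComplexL2.

Section Adjoint.
Context d1 d2 (T1 : measurableType d1) (T2 : measurableType d2) (R : realType).
Variables (mu1 : {measure set T1 -> \bar R}) (mu2 : {measure set T2 -> \bar R}).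

(* For a bounded operator A : L^2(mu1) -> L^2(mu2), the a.e. unique h in
   L^2(mu1) with <h, g> = <F, A g> for all g. *)
Definition adjoint (A : (T1 -> R[i]) -> (T2 -> R[i])) (F : T2 -> R[i]) :
    T1 -> R[i] :=
  xget (fun=> 0) [set h | L2 mu1 h /\
    forall g, L2 mu1 g -> inner mu1 h g = inner mu2 F (A g)].

End Adjoint.

Section TimeFrequency.
Context {R : realType} {d : nat}.
Local Notation Rd := (d.-tuple R).
Local Notation R2d := (d.-tuple R * d.-tuple R)%type.
Implicit Types (x y w : Rd) (z c : R2d) (Omega : set R2d).

Definition dot x y : R := \sum_(i < d) tnth x i * tnth y i.
Definition subt x y : Rd := [tuple tnth x i - tnth y i | i < d].

Definition leb2 : {measure set R2d -> \bar R} := (leb R d \x leb R d)%E.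

Definition expi (t : R) : R[i] := Complex (cos t) (sin t).

Definition gaussian x : R[i] :=
  (2 `^ (d%:R / 4) * expR (- pi * dot x x))%:C%C.

(* z = (x, omega) *)
Definition stft (f : Rd -> R[i]) z : R[i] :=
  cintegral (leb R d)
    (fun y => f y * (gaussian (subt y z.1))^*%C * expi (- (2 * pi * dot z.2 y))).

Definition loc_op Omega (f : Rd -> R[i]) : Rd -> R[i] :=
  adjoint (leb R d) leb2 stft (fun z => (\1_Omega z)%:C%C * stft f z).

Definition ball2 c (r : R) : set R2d :=
  [set z | dot (subt z.1 c.1) (subt z.1 c.1)
           + dot (subt z.2 c.2) (subt z.2 c.2) < r ^+ 2].

Definition origin : R2d := ([tuple 0 | _ < d], [tuple 0 | _ < d]).

(* The radius is unique, leb2 (ball2 origin r) being strictly increasing in r. *)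
Definition symm_rearr Omega : set R2d :=
  ball2 origin (xget 0 [set r | 0 < r /\ leb2 (ball2 origin r) = leb2 Omega]).

Definition asymmetry Omega : R :=
  inf [set fine (leb2 (Omega `+` B)) / fine (leb2 Omega) | B in
    [set B | (exists c r, 0 < r /\ B = ball2 c r) /\ leb2 B = leb2 Omega]].

End TimeFrequency.

Definition beta {R : realType} (d : nat) (c2 t : R) : R :=
  if t <= 1 then t `^ (2 + d%:R^-1) else t ^+ 2 * expR (- c2 * t `^ d%:R^-1).

(* Main.v *)
From HB Require Import structures.
Require Import Defs.
From mathcomp Require Import all_boot all_order all_algebra finmap.
From mathcomp Require Import all_classical all_reals all_analysis.
From mathcomp Require Import measurable_realfun complex ring lra.
Set Implicit Arguments.
Unset Strict Implicit.
Unset Printing Implicit Defensive.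
Import Order.TTheory GRing.Theory Num.Theory numFieldNormedType.Exports.
Local Open Scope classical_set_scope.
Local Open Scope ring_scope.

(** With [atom z] the time-frequency shift of the Gaussian by [z], the operator
[L_Omega] is the integral over [Omega] of the rank-one projections onto the
[atom z]. Let [B] be a centered ball and [B_s] its image under the shear
[(x, w) |-> (x, w + s x)], so that [|B_s| = |B|].

The kernel of [(L_(B_s) + L_(B_-s)) / 2 - L_B] is that of [L_B] with the factor
[cos (2 pi s x.(y' - y)) - 1 = O(s^2)] inserted under the integral. By Bessel's
inequality its Hilbert-Schmidt norm is [O(s^2)], so the squared norms satisfy
[|L_(B_s)|^2 + |L_(B_-s)|^2 >= 2 |L_B|^2 - O(s^2)]. All of this is done on finite
parts of one and the same orthonormal basis, so neither Parseval's identity nor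
the completeness of [L^2] is needed; Zorn's lemma provides a basis.

On the other hand the asymmetry of [B_s] is at least a constant times [|s|]: the
integral of [x.w] changes by [s * \int_B |x|^2] under the shear, and the central
symmetry of [B_s] makes centered balls optimal up to a factor 2. Letting [s] tend
to 0 contradicts any exponent [gamma < 2]. *)

(** * Complex-valued square-integrable functions *)

(** Shears are chosen because they fix the position component. Frequency enters an [atom] only
    through a phase of modulus one, so every Gaussian bound depends on the position bound [rho]
    alone, and one [rho] serves the ball and all its shears. In the kernel the shear is a phase that
    is conjugated when [s] changes sign, so averaging opposite shears removes the first order
    exactly. Passing from operators to squared norms leaves a cross term between [L_B] and the
    defect, linear in the defect; splitting it with weights [s^2] and [s^-2] makes both halves of
    order [s^2]. All sheared balls have the same volume, so [beta] and [c2] enter as one positive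
    constant. A negative [gamma] reverses the monotonicity of the power and is refuted with the
    upper bound 2 on the asymmetry instead of the linear lower bound. Some objects are defined by a
    choice ([adjoint], the radius in [symm_rearr]). The chosen element is never identified: [loc_op]
    is handled through its inner products, and the radius by repeating the same choice. *)

Local Notation re := complex.Re.
Local Notation im := complex.Im.

Section ComplexNumbers.
Context {R : realType}.
Implicit Types x y : R[i].

Lemma re_add x y : re (x + y) = re x + re y. Proof. by case: x; case: y. Qed.
Lemma im_add x y : im (x + y) = im x + im y. Proof. by case: x; case: y. Qed.
Lemma re_opp x : re (- x) = - re x. Proof. by case: x. Qed.
Lemma im_opp x : im (- x) = - im x. Proof. by case: x. Qed.
Lemma re_mul x y : re (x * y) = re x * re y - im x * im y.
Proof. by case: x; case: y. Qed.
Lemma im_mul x y : im (x * y) = re x * im y + im x * re y.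
Proof. by case: x => a b; case: y => c e. Qed.
Lemma re_conj x : re (x^*)%C = re x. Proof. by case: x. Qed.
Lemma im_conj x : im (x^*)%C = - im x. Proof. by case: x. Qed.

Lemma conj_add x y : conjc (x + y) = conjc x + conjc y. Proof. by rewrite rmorphD. Qed.
Lemma conj_mul x y : conjc (x * y) = conjc x * conjc y. Proof. by rewrite rmorphM. Qed.

Definition reimE := (re_add, im_add, re_opp, im_opp, re_mul, im_mul, re_conj, im_conj).

Lemma complex_eq x y : re x = re y -> im x = im y -> x = y.
Proof. by case: x; case: y => /= ? ? ? ? -> ->. Qed.

(** The squared modulus as a polynomial in the real and imaginary parts: without the square root of
    [normc], its identities and inequalities fall to [ring] and [nra]. *)
Definition sqn x : R := re x ^+ 2 + im x ^+ 2.

Lemma normc_sqr x : Normc.normc x ^+ 2 = sqn x.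
Proof. by case: x => a b; rewrite /Normc.normc sqr_sqrtr// addr_ge0// sqr_ge0. Qed.

Lemma sqn_ge0 x : 0 <= sqn x. Proof. by rewrite addr_ge0// sqr_ge0. Qed.

Lemma sqnM x y : sqn (x * y) = sqn x * sqn y.
Proof. by rewrite /sqn !reimE; ring. Qed.

Lemma sqn_conj x : sqn (x^*)%C = sqn x.
Proof. by rewrite /sqn !reimE sqrrN. Qed.

Lemma sqn_real (a : R) : sqn (a%:C)%C = a ^+ 2.
Proof. by rewrite /sqn/= expr0n addr0. Qed.

Lemma re_mul_le x y : `|re (x * y)| <= (sqn x + sqn y) / 2.
Proof. case: x y => a b [c e]; rewrite /sqn !reimE /= ler_norml.
have := (sqr_ge0 (a - c), sqr_ge0 (a + c), sqr_ge0 (b - e), sqr_ge0 (b + e)).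
by move=> [[[? ?] ?] ?]; apply/andP; split; nra.
Qed.

Lemma im_mul_le x y : `|im (x * y)| <= (sqn x + sqn y) / 2.
Proof. case: x y => a b [c e]; rewrite /sqn !reimE /= ler_norml.
have := (sqr_ge0 (a - e), sqr_ge0 (a + e), sqr_ge0 (b - c), sqr_ge0 (b + c)).
by move=> [[[? ?] ?] ?]; apply/andP; split; nra.
Qed.

Lemma sqn_addr_le x y : sqn (x + y) <= 2 * sqn x + 2 * sqn y.
Proof.
case: x y => a b [c e]; rewrite /sqn /=.
have := (sqr_ge0 (a - c), sqr_ge0 (b - e)).
by move=> [? ?]; nra.
Qed.

End ComplexNumbers.

Section ComplexIntegral.
Context d (T : measurableType d) (R : realType).
Variable mu : {measure set T -> \bar R}.
Implicit Types f g e : T -> R[i].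

Definition cmeas f := measurable_fun setT (fun x => re (f x)) /\
  measurable_fun setT (fun x => im (f x)).

Definition cint f := mu.-integrable setT (EFin \o (fun x => re (f x))) /\
  mu.-integrable setT (EFin \o (fun x => im (f x))).

Lemma cmeasD f g : cmeas f -> cmeas g -> cmeas (fun x => f x + g x).
Proof.
move=> [rf imf] [rg ig]; split.
- by under eq_fun do rewrite re_add; exact: measurable_funD.
- by under eq_fun do rewrite im_add; exact: measurable_funD.
Qed.

Lemma cmeasM f g : cmeas f -> cmeas g -> cmeas (fun x => f x * g x).
Proof.
move=> [rf imf] [rg ig]; split.
- by under eq_fun do rewrite re_mul; apply: measurable_funB; exact: measurable_funM.
- by under eq_fun do rewrite im_mul; apply: measurable_funD; exact: measurable_funM.
Qed.

Lemma cmeas_conj f : cmeas f -> cmeas (fun x => (f x)^*%C).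
Proof.
move=> [rf imf]; split.
- by under eq_fun do rewrite re_conj.
- by under eq_fun do rewrite im_conj; exact: measurableT_comp.
Qed.

Lemma cmeas_cst c : cmeas (fun=> c).
Proof. by split; exact: measurable_cst. Qed.

Lemma cmeas_real (h : T -> R) : measurable_fun setT h -> cmeas (fun x => (h x)%:C%C).
Proof. by move=> mh; split => //; exact: measurable_cst. Qed.

Lemma cmeas_sqn f : cmeas f -> measurable_fun setT (fun x => sqn (f x)).
Proof. by move=> [rf imf]; apply: measurable_funD; exact: measurable_funX. Qed.

Lemma integrable_le (f g : T -> R) : measurable_fun setT f ->
  mu.-integrable setT (EFin \o g) -> (forall x, `|f x| <= g x) ->
  mu.-integrable setT (EFin \o f).
Proof.
move=> mf ig fg; apply: le_integrable ig => //; first exact/measurable_EFinP.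
by move=> x _ /=; rewrite lee_fin; apply: le_trans (fg x) _; exact: ler_norm.
Qed.

Lemma integrableRD (f g : T -> R) : mu.-integrable setT (EFin \o f) ->
  mu.-integrable setT (EFin \o g) -> mu.-integrable setT (EFin \o (fun x => f x + g x)).
Proof.
move=> fi gi; rewrite (_ : EFin \o _ = (EFin \o f) \+ (EFin \o g))%E//.
exact: integrableD.
Qed.

Lemma integrableRB (f g : T -> R) : mu.-integrable setT (EFin \o f) ->
  mu.-integrable setT (EFin \o g) -> mu.-integrable setT (EFin \o (fun x => f x - g x)).
Proof.
move=> fi gi; rewrite (_ : EFin \o _ = (EFin \o f) \- (EFin \o g))%E//.
exact: integrableB.
Qed.

Lemma integrableRZ (c : R) (f : T -> R) : mu.-integrable setT (EFin \o f) ->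
  mu.-integrable setT (EFin \o (fun x => c * f x)).
Proof.
move=> fi; rewrite (_ : EFin \o _ = (fun x => c%:E * (EFin \o f) x)%E)//.
exact: integrableZl.
Qed.

Lemma cintD f g : cint f -> cint g -> cint (fun x => f x + g x).
Proof.
move=> [rf imf] [rg ig]; split.
- by under eq_fun do rewrite re_add; exact: integrableRD.
- by under eq_fun do rewrite im_add; exact: integrableRD.
Qed.

Lemma cintZ c f : cint f -> cint (fun x => c * f x).
Proof.
move=> [rf imf]; split.
- by under eq_fun do rewrite re_mul; apply: integrableRB; exact: integrableRZ.
- by under eq_fun do rewrite im_mul; apply: integrableRD; exact: integrableRZ.
Qed.

Lemma cint_le f (h : T -> R) : cmeas f -> mu.-integrable setT (EFin \o h) ->
  (forall x, `|re (f x)| <= h x) -> (forall x, `|im (f x)| <= h x) -> cint f.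
Proof. by move=> [mr mi] ih hr hi; split; apply: integrable_le ih _. Qed.

Lemma cintegralD f g : cint f -> cint g ->
  cintegral mu (fun x => f x + g x) = cintegral mu f + cintegral mu g.
Proof.
move=> [rf imf] [rg ig]; apply: complex_eq; rewrite reimE /=.
- by under eq_Rintegral do rewrite re_add; rewrite RintegralD.
- by under eq_Rintegral do rewrite im_add; rewrite RintegralD.
Qed.

Lemma cintegralZ c f : cint f -> cintegral mu (fun x => c * f x) = c * cintegral mu f.
Proof.
move=> [rf imf]; apply: complex_eq; rewrite reimE /=.
- under eq_Rintegral do rewrite re_mul.
  by rewrite RintegralB ?RintegralZl//; exact: integrableRZ.
- under eq_Rintegral do rewrite im_mul.
  by rewrite RintegralD ?RintegralZl//; exact: integrableRZ.
Qed.

Lemma cintegral_conj f : cint f ->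
  cintegral mu (fun x => (f x)^*%C) = ((cintegral mu f)^*)%C.
Proof.
move=> [rf imf]; apply: complex_eq; rewrite reimE /=.
- by under eq_Rintegral do rewrite re_conj.
- under eq_Rintegral do rewrite im_conj -mulN1r.
  by rewrite RintegralZl// mulN1r.
Qed.

Lemma eq_cintegral f g : f =1 g -> cintegral mu f = cintegral mu g.
Proof. by move=> /funext ->. Qed.

(** Real-valued form of [L2norm2], meaningful on [L2], where the integral is finite; [fine] sends
    [+oo] to 0. *)
Definition nrm f : R := \int[mu]_x sqn (f x).

Lemma L2norm2E f : L2norm2 mu f = (\int[mu]_x (sqn (f x))%:E)%E.
Proof. by apply: eq_integral => x _; rewrite normc_sqr. Qed.

Lemma L2P f : L2 mu f <-> cmeas f /\ mu.-integrable setT (EFin \o (fun x => sqn (f x))).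
Proof.
rewrite /L2 /= L2norm2E; split=> [[rf imf foo]|[mf /integrableP[_ foo]]].
  split=> //; apply/integrableP; split.
    by apply/measurable_EFinP; exact: cmeas_sqn.
  by under eq_integral do rewrite /= ger0_norm ?sqn_ge0//.
case: mf => ? ?; split => //; apply: le_lt_trans foo.
by under [leRHS]eq_integral do rewrite /= ger0_norm ?sqn_ge0//.
Qed.

Lemma L2norm2_fin f : L2 mu f -> L2norm2 mu f = (nrm f)%:E.
Proof.
by move=> /L2P[_ fi]; rewrite L2norm2E /nrm /Rintegral fineK//; exact: integrable_fin_num.
Qed.

Lemma nrm_ge0 f : 0 <= nrm f.
Proof. by apply: Rintegral_ge0 => x _; exact: sqn_ge0. Qed.

Lemma L2_cmeas f : L2 mu f -> cmeas f. Proof. by move/L2P => []. Qed.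

Lemma L2_le f (h : T -> R) : cmeas f -> mu.-integrable setT (EFin \o h) ->
  (forall x, sqn (f x) <= h x) -> L2 mu f.
Proof.
move=> mf ih fh; apply/L2P; split => //; apply: integrable_le ih _.
- exact: cmeas_sqn.
- by move=> x; rewrite ger0_norm// sqn_ge0.
Qed.

Lemma L2_int f : L2 mu f -> mu.-integrable setT (EFin \o (fun x => sqn (f x))).
Proof. by move/L2P => []. Qed.

Lemma L2D f g : L2 mu f -> L2 mu g -> L2 mu (fun x => f x + g x).
Proof.
move=> Lf Lg; apply: (@L2_le _ (fun x => 2 * sqn (f x) + 2 * sqn (g x))).
- by apply: cmeasD; exact: L2_cmeas.
- by apply: integrableRD; apply: integrableRZ; exact: L2_int.
- by move=> x; exact: sqn_addr_le.
Qed.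

Lemma L2Z c f : L2 mu f -> L2 mu (fun x => c * f x).
Proof.
move=> Lf; apply: (@L2_le _ (fun x => sqn c * sqn (f x))).
- by apply: cmeasM; [exact: cmeas_cst|exact: L2_cmeas].
- by apply: integrableRZ; exact: L2_int.
- by move=> x; rewrite sqnM.
Qed.

Lemma L2_conj f : L2 mu f -> L2 mu (fun x => (f x)^*%C).
Proof.
move=> Lf; apply: (@L2_le _ (fun x => sqn (f x))).
- by apply: cmeas_conj; exact: L2_cmeas.
- exact: L2_int.
- by move=> x; rewrite sqn_conj.
Qed.

Lemma cint_mul f g : L2 mu f -> L2 mu g -> cint (fun x => f x * g x).
Proof.
move=> Lf Lg; apply: (@cint_le _ (fun x => 2^-1 * (sqn (f x) + sqn (g x)))).
- by apply: cmeasM; exact: L2_cmeas.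
- by apply: integrableRZ; apply: integrableRD; exact: L2_int.
- by move=> x; rewrite [leRHS]mulrC re_mul_le.
- by move=> x; rewrite [leRHS]mulrC im_mul_le.
Qed.

Lemma cint_inner f g : L2 mu f -> L2 mu g -> cint (fun x => f x * (g x)^*%C).
Proof. by move=> Lf /L2_conj; exact: cint_mul. Qed.

Lemma innerDl f1 f2 g : L2 mu f1 -> L2 mu f2 -> L2 mu g ->
  inner mu (fun x => f1 x + f2 x) g = inner mu f1 g + inner mu f2 g.
Proof.
move=> L1 L2 Lg; rewrite /inner -cintegralD; try exact: cint_inner.
by apply: eq_cintegral => x; rewrite mulrDl.
Qed.

Lemma innerZl c f g : L2 mu f -> L2 mu g ->
  inner mu (fun x => c * f x) g = c * inner mu f g.
Proof.
move=> L1 Lg; rewrite /inner -cintegralZ; last exact: cint_inner.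
by apply: eq_cintegral => x; rewrite mulrA.
Qed.

Lemma inner_conj f g : L2 mu f -> L2 mu g -> inner mu g f = ((inner mu f g)^*)%C.
Proof.
move=> Lf Lg; rewrite /inner -cintegral_conj; last exact: cint_inner.
by apply: eq_cintegral => x; rewrite conj_mul conjcK mulrC.
Qed.

Lemma inner_self f : L2 mu f -> inner mu f f = (nrm f)%:C%C.
Proof.
move=> Lf; apply: complex_eq => /=.
- by apply: eq_Rintegral => x _; rewrite !reimE /sqn; ring.
- under eq_Rintegral do rewrite !reimE mulrN [X in _ + X]mulrC addNr.
  by rewrite Rintegral_cst//= mul0r.
Qed.

Lemma re_inner_self f : L2 mu f -> re (inner mu f f) = nrm f.
Proof. by move=> /inner_self ->. Qed.

Lemma innerDr f g1 g2 : L2 mu f -> L2 mu g1 -> L2 mu g2 ->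
  inner mu f (fun x => g1 x + g2 x) = inner mu f g1 + inner mu f g2.
Proof.
move=> Lf L1 L2; rewrite inner_conj//; last exact: L2D.
by rewrite innerDl// conj_add -!inner_conj.
Qed.

Lemma innerZr c f g : L2 mu f -> L2 mu g ->
  inner mu f (fun x => c * g x) = (c^*)%C * inner mu f g.
Proof.
move=> Lf Lg; rewrite inner_conj//; last exact: L2Z.
by rewrite innerZl// conj_mul -inner_conj.
Qed.

Lemma Rintegral_sum (I : eqType) (s : seq I) (f : I -> T -> R) :
  (forall i, i \in s -> mu.-integrable setT (EFin \o f i)) ->
  mu.-integrable setT (EFin \o (fun x => \sum_(i <- s) f i x)) /\
  \int[mu]_x (\sum_(i <- s) f i x) = \sum_(i <- s) \int[mu]_x f i x.
Proof.
elim: s => [_|i s IH fi].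
  split; first by under eq_fun do rewrite big_nil; exact: integrable0.
  by under eq_Rintegral do rewrite big_nil; rewrite Rintegral_cst// mul0r big_nil.
have ii : mu.-integrable setT (EFin \o f i) by apply: fi; rewrite mem_head.
have [|si E] := IH; first by move=> j js; apply: fi; rewrite inE js orbT.
split; first by under eq_fun do rewrite big_cons; exact: integrableRD.
by under eq_Rintegral do rewrite big_cons; rewrite RintegralD// E big_cons.
Qed.

Lemma Rintegral_mono (f g : T -> R) : mu.-integrable setT (EFin \o f) ->
  mu.-integrable setT (EFin \o g) -> (forall x, f x <= g x) ->
  \int[mu]_x f x <= \int[mu]_x g x.
Proof. by move=> fi gi fg; exact: le_Rintegral. Qed.

(** * Orthonormal families: Bessel's inequality and existence of a basis *)

Definition orthonormal_family (E : set (T -> R[i])) := [/\ E `<=` L2 mu,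
  forall e, E e -> inner mu e e = 1 &
  forall e e', E e -> E e' -> e <> e' -> inner mu e e' = 0].

(** Induction on the list: removing from [f] its component along the head [e] lowers [nrm] by
    [sqn c] and leaves the coefficients along the remaining members unchanged, as these are
    orthogonal to [e]. *)
Lemma bessel (E : set (T -> R[i])) (s : seq (T -> R[i])) f : orthonormal_family E ->
  uniq s -> (forall e, e \in s -> E e) -> L2 mu f ->
  \sum_(e <- s) sqn (inner mu f e) <= nrm f.
Proof.
move=> [EL2 E1 E0]; elim: s f => [|e s IH] f /=; first by rewrite big_nil nrm_ge0.
move=> /andP[es us] sE Lf; rewrite big_cons.
have Ee : E e by apply: sE; rewrite mem_head.
have Le := EL2 _ Ee.
set c := inner mu f e.
pose g x := f x + (- c) * e x.
have Lce : L2 mu (fun x => (- c) * e x) by exact: L2Z.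
have Lg : L2 mu g by exact: L2D.
have IHg := IH g us (fun e' h => sE e' (mem_behead (s := e :: s) h)) Lg.
have ge : inner mu g e = 0 by rewrite innerDl// innerZl// E1// mulr1 subrr.
have gf : inner mu g f = inner mu f f - (sqn c)%:C%C.
  rewrite innerDl// innerZl//; congr (_ + _).
  rewrite (inner_conj Lf Le) -/c; case: (c) => a b.
  by apply: complex_eq; rewrite /= /sqn/=; ring.
have ng : nrm g = nrm f - sqn c.
  rewrite -(re_inner_self Lg) /g innerDr// innerZr// -/g gf ge mulr0 addr0.
  by rewrite re_add re_inner_self // re_opp.
suff -> : \sum_(e' <- s) sqn (inner mu f e') = \sum_(e' <- s) sqn (inner mu g e').
  by rewrite addrC -lerBrDr -ng.
apply: eq_big_seq => e' e's.
have Ee' : E e' by apply: sE; rewrite inE e's orbT.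
have Le' := EL2 _ Ee'.
rewrite innerDl// innerZl// (E0 e e') ?mulr0 ?addr0// => ee'.
by move: es; rewrite ee' e's.
Qed.

Lemma nrm_eq0 f : L2 mu f -> nrm f = 0 -> {ae mu, forall x, f x = 0}.
Proof.
move=> Lf f0; have [_ mf] := (L2P f).1 Lf.
have := L2norm2_fin Lf; rewrite f0 L2norm2E => I0.
have /(ae_eq_integral_abs mu measurableT) [/(_ _) + _] :=
  measurable_int mu mf.
have I1 : (\int[mu]_x `|(EFin \o (fun x => sqn (f x))) x|)%E = 0%E.
  by rewrite -[RHS]I0; apply: eq_integral => x _ /=; rewrite ger0_norm// sqn_ge0.
move=> /(_ I1); apply: filterS => x /(_ I) /= [] fx0.
by apply: complex_eq => /=; move: fx0; rewrite /sqn; nra.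
Qed.

(** A maximal orthonormal family is total: a function orthogonal to it and not a.e. zero could be
    normalised and adjoined. Unions of chains stay orthonormal because each condition involves at
    most two members. *)
Lemma exists_orthonormal_basis : exists E, orthonormal_basis mu E.
Proof.
have [|E [[EL2 E1 E0] Emax]] := @Zorn_bigcup _ [set E | orthonormal_family E].
  move=> F FP totF; split.
  - by move=> e [X FX Xe]; have [+ _ _] := FP _ FX; exact.
  - by move=> e [X FX Xe]; have [_ + _] := FP _ FX; exact.
  - move=> e e' [X FX Xe] [Y FY Ye'].
    have [XY|YX] := totF _ _ FX FY.
      by have [_ _ +] := FP _ FY; apply => //; exact: XY.
    by have [_ _ +] := FP _ FX; apply => //; exact: YX.
exists E; split => // f Lf fE; apply: contrapT => nf0.
have nf : nrm f != 0 by apply/eqP => /(nrm_eq0 Lf).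
have nfp : 0 < nrm f by rewrite lt_def nf nrm_ge0.
pose c : R[i] := ((Num.sqrt (nrm f))^-1)%:C%C.
pose e0 x := c * f x.
have Le0 : L2 mu e0 by exact: L2Z.
have e0E e : E e -> inner mu e0 e = 0.
  by move=> Ee; rewrite innerZl//; [rewrite fE// mulr0|exact: EL2].
have Ee0 e : E e -> inner mu e e0 = 0.
  move=> Ee; rewrite inner_conj//; last exact: EL2.
  by rewrite e0E// conjc0.
have e01 : inner mu e0 e0 = 1.
  rewrite innerZl// innerZr// inner_self//; apply: complex_eq; rewrite !reimE /=; last by ring.
  rewrite !(mul0r, mulr0, addr0, subr0, oppr0).
  rewrite mulrA -invfM -expr2 sqr_sqrtr ?mulVf//; exact: ltW.
have nE : ~ E e0.
  by move=> /e0E; rewrite e01 => /eqP; rewrite oner_eq0.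
apply: (Emax (E `|` [set e0])).
  split; first by left.
  by move=> /(_ e0) h; apply/nE/h; right.
split.
- by move=> e [/EL2//|->].
- by move=> e [/E1//|->].
- by move=> e e' [Ee|->] [Ee'|->] ee' //; [exact: E0|exact: Ee0|exact: e0E].
Qed.

Lemma orthonormal_basis_family E : orthonormal_basis mu E -> orthonormal_family E.
Proof. by case. Qed.

Lemma integrable_indic_fin (A : set T) : measurable A -> (mu A < +oo)%E ->
  mu.-integrable setT (EFin \o (\1_A : T -> R)).
Proof.
move=> mA Aoo; apply/integrableP; split; first exact/measurable_EFinP.
under eq_integral do rewrite /= ger0_norm//.
by rewrite integral_indic// setIT.
Qed.

(* [\int (t - f)^2 >= 0] at [t] the mean of [f], up to the normalization of [mu A] *)
Lemma sqr_Rintegral_le (A : set T) (f : T -> R) (v : R) : measurable A ->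
  mu A = v%:E -> (0 < v) ->
  mu.-integrable setT (EFin \o (fun x => \1_A x * f x)) ->
  mu.-integrable setT (EFin \o (fun x => \1_A x * f x ^+ 2)) ->
  (\int[mu]_x (\1_A x * f x)) ^+ 2 <= v * \int[mu]_x (\1_A x * f x ^+ 2).
Proof.
move=> mA vA v0 fi f2i; set I1 := \int[mu]_x (\1_A x * f x).
have A1 : mu.-integrable setT (EFin \o (\1_A : T -> R)).
  by apply: integrable_indic_fin => //; rewrite vA ltry.
have I0 : \int[mu]_x (\1_A x : R) = v.
  by rewrite /Rintegral integral_indic// setIT vA.
pose t := I1 / v.
have : 0 <= \int[mu]_x ((\1_A x * f x ^+ 2 + (- (2 * t)) * (\1_A x * f x)) + t ^+ 2 * \1_A x).
  apply: Rintegral_ge0 => x _; rewrite (_ : _ + _ = \1_A x * (f x - t) ^+ 2); last by ring.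
  by rewrite mulr_ge0// sqr_ge0.
rewrite RintegralD//; [|by apply: integrableRD => //; exact: integrableRZ|exact: integrableRZ].
rewrite RintegralD//; [|exact: integrableRZ].
rewrite !RintegralZl// I0 -/I1 => h.
have : 0 <= v * (\int[mu]_x (\1_A x * f x ^+ 2) + - (2 * t) * I1 + t ^+ 2 * v).
  by rewrite mulr_ge0// ltW.
rewrite (_ : v * _ = v * \int[mu]_x (\1_A x * f x ^+ 2) - I1 ^+ 2) ?subr_ge0//.
by rewrite /t; field; rewrite gt_eqF.
Qed.

End ComplexIntegral.

(** * Lebesgue measure on tuples *)

Section MeasurePreserving.
Context d (T : measurableType d) (R : realType).
Variable m : {measure set T -> \bar R}.

Definition measure_preserving (f : T -> T) := measurable_fun setT f /\
  forall A, measurable A -> m (f @^-1` A) = m A.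

Lemma ge0_integral_preserving f (h : T -> \bar R) : measure_preserving f ->
  measurable_fun setT h -> (forall x, 0 <= h x)%E ->
  (\int[m]_x h (f x) = \int[m]_x h x)%E.
Proof.
move=> [mf fm] mh h0.
rewrite -[LHS]/(\int[m]_(x in f @^-1` setT) (h \o f) x)%E.
rewrite -(ge0_integral_pushforward mf)//.
by apply: eq_measure_integral => A mA _; exact: fm.
Qed.

Lemma integral_preserving f (h : T -> \bar R) : measure_preserving f ->
  measurable_fun setT h -> (\int[m]_x h (f x) = \int[m]_x h x)%E.
Proof.
move=> fm mh; rewrite [LHS]integralE [RHS]integralE; congr (_ - _)%E.
- rewrite -[RHS](ge0_integral_preserving fm)//; last exact: measurable_funepos.
  by apply: eq_integral => x _; rewrite !funeposE.
- rewrite -[RHS](ge0_integral_preserving fm)//; last exact: measurable_funeneg.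
  by apply: eq_integral => x _; rewrite !funenegE.
Qed.

Lemma Rintegral_preserving f (h : T -> R) : measure_preserving f ->
  measurable_fun setT h -> \int[m]_x h (f x) = \int[m]_x h x.
Proof.
move=> fm mh; rewrite /Rintegral; congr fine.
by apply: (integral_preserving fm (h := EFin \o h)); exact/measurable_EFinP.
Qed.

End MeasurePreserving.

Section SkewProduct.
Context d1 d2 (T1 : measurableType d1) (T2 : measurableType d2) (R : realType).
Variables (m1 : {sigma_finite_measure set T1 -> \bar R}).
Variables (m2 : {sigma_finite_measure set T2 -> \bar R}).

(** The slice over [x] of the preimage of [A] is the preimage under [g x] of the slice of [A] over
    [f x]. So [g x] preserves the measure of each slice, and [f] the integral of these measures. *)
Lemma skew_product_preserving (f : T1 -> T1) (g : T1 -> T2 -> T2) :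
  measure_preserving m1 f -> (forall x, measure_preserving m2 (g x)) ->
  measurable_fun setT (fun z : T1 * T2 => (f z.1, g z.1 z.2)) ->
  measure_preserving (m1 \x m2)%E (fun z => (f z.1, g z.1 z.2)).
Proof.
move=> fm gm mfg; split => // A mA.
rewrite /product_measure1 -[RHS](ge0_integral_preserving fm)//; last first.
  exact: measurable_fun_xsection.
apply: eq_integral => x _ /=.
rewrite -[RHS](proj2 (gm x)); last exact: measurable_xsection.
by congr (m2 _); apply/seteqP; split => y; rewrite /xsection /= !inE.
Qed.

End SkewProduct.

Section LebesgueTuple.
Context {R : realType}.
Implicit Type s : R.

(** Slope 1 serves translations and shears, slope -1 the reflection at the origin. Translations
    follow from the uniqueness of Lebesgue measure given its values on half-open intervals. *)
Lemma lebesgue_affine s (a : R) : s = 1 \/ s = -1 ->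
  measure_preserving (@lebesgue_measure R)
    ((fun x => s * x + a) : measurableTypeR R -> measurableTypeR R).
Proof.
have trans : measure_preserving (@lebesgue_measure R)
    ((fun x => x + a) : measurableTypeR R -> measurableTypeR R).
  have mt : measurable_fun setT ((fun x => x + a) : measurableTypeR R -> measurableTypeR R).
    exact: measurable_funD.
  split => // A mA; apply/esym.
  pose mt' := isMeasurableFun.Build _ _ _ _ _ mt.
  pose tp : {mfun measurableTypeR R >-> measurableTypeR R} := HB.pack
    (fun x : measurableTypeR R => x + a : measurableTypeR R) mt'.
  apply: (@lebesgue_measure_unique R (pushforward lebesgue_measure tp)) => //.
  move=> _ [[x y] _ <-] /=.
  transitivity (@lebesgue_measure R `]x - a, y - a]%classic); last first.
    congr (lebesgue_measure _).
    by apply/seteqP; split => z /=; rewrite !in_itv/= ltrBlDr lerBrDr.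
  rewrite !lebesgue_measure_itv/= !lte_fin ltrD2r.
  by case: ifP => // _; rewrite -!EFinB; congr EFin; ring.
have opp : measure_preserving (@lebesgue_measure R)
    (-%R : measurableTypeR R -> measurableTypeR R).
  split; last by move=> A mA; exact: lebesgue_measureN.
  exact: measurable_funN.
case=> ->; first by under eq_fun do rewrite mul1r.
under eq_fun do rewrite mulN1r.
split.
  by have [mt _] := trans; have [mo _] := opp; exact: (measurableT_comp mt mo).
move=> A mA; have [mt tm] := trans; have [_ om] := opp.
rewrite -[RHS]tm// -[RHS]om//.
by rewrite -[X in measurable X]setTI; exact: mt.
Qed.

Definition affine_tuple n s (a : n.-tuple R) (t : n.-tuple R) : n.-tuple R :=
  [tuple s * tnth t i + tnth a i | i < n].

Lemma measurable_affine_tuple n s a : measurable_fun setT (@affine_tuple n s a).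
Proof.
apply/measurable_fun_tnthP => i.
rewrite (_ : _ \o _ = fun t => s * tnth t i + tnth a i); last first.
  by apply/funext => t /=; rewrite tnth_mktuple.
by apply: measurable_funD => //; apply: measurable_funM => //; exact: measurable_tnth.
Qed.

Lemma lebSE n (A : set (n.+1.-tuple R)) :
  leb R n.+1 A = (@lebesgue_measure R \x leb R n)%E ((@consp R n) @^-1` A).
Proof. by []. Qed.

Lemma measurable_consp_preimage n (A : set (n.+1.-tuple R)) : measurable A ->
  measurable ((@consp R n) @^-1` A).
Proof. by move=> mA; rewrite -[X in measurable X]setTI; exact: measurable_consp. Qed.

Lemma leb_affine n s a : s = 1 \/ s = -1 ->
  measure_preserving (leb R n) (@affine_tuple n s a).
Proof.
move=> s1; split; first exact: measurable_affine_tuple.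
elim: n a => [a A mA|n IH a A mA].
  by congr (leb R 0 _); apply/seteqP; split=> t; rewrite /= [affine_tuple _ _ _]tuple0 [t]tuple0.
rewrite -[RHS]/((@lebesgue_measure R \x leb R n)%E ((@consp R n) @^-1` A)).
rewrite -[LHS]/((@lebesgue_measure R \x leb R n)%E ((@consp R n) @^-1` (affine_tuple s a @^-1` A))).
pose f := (fun x => s * x + tnth a ord0) : measurableTypeR R -> measurableTypeR R.
pose g := fun _ : measurableTypeR R => @affine_tuple n s [tuple of behead a].
have fm : measure_preserving (@lebesgue_measure R) f by exact: lebesgue_affine.
have gm x : measure_preserving (leb R n) (g x).
  by split; [exact: measurable_affine_tuple|move=> B mB; exact: IH].
rewrite -[RHS](proj2 (skew_product_preserving fm gm _)); first last.
- exact: measurable_consp_preimage.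
- apply: measurable_fun_pair; last first.
    by apply: (measurableT_comp (measurable_affine_tuple _ _)); exact: measurable_snd.
  by have [mf _] := fm; apply: (measurableT_comp mf); exact: measurable_fst.
congr ((_ \x _)%E _); apply/funext => -[x t] /=.
rewrite /preimage/=; congr A; apply: eq_from_tnth => i.
rewrite tnth_mktuple.
have [j ->|->] := unliftP ord0 i; rewrite ?tnthS ?tnth0//=.
rewrite /g tnth_mktuple tnth_behead; congr (_ + tnth a _); apply: val_inj => /=.
by rewrite inordK // ltnS ltn_ord.
Qed.

Lemma ge0_integral_lebS n (h : n.+1.-tuple R -> \bar R) : measurable_fun setT h ->
  (forall t, 0 <= h t)%E ->
  (\int[leb R n.+1]_t h t =
   \int[lebesgue_measure]_(x in [set: measurableTypeR R]) \int[leb R n]_t h (consp (x, t)))%E.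
Proof.
move=> mh h0.
rewrite -(fubini_tonelli1 (fun z => h (@consp R n z)))//; last first.
  by apply: (measurableT_comp mh); exact: measurable_consp.
rewrite -[RHS](@ge0_integral_pushforward _ _ _ _ _ _ (@measurable_consp R n) _ setT)//.
Qed.

Lemma measurable_dot dd (T : measurableType dd) n (f g : T -> n.-tuple R) :
  measurable_fun setT f -> measurable_fun setT g ->
  measurable_fun setT (fun x => dot (f x) (g x)).
Proof.
move=> mf mg; apply: measurable_sum => i; apply: measurable_funM.
- by apply: (measurableT_comp (measurable_tnth i)).
- by apply: (measurableT_comp (measurable_tnth i)).
Qed.

Lemma dot_ge0 n (x : n.-tuple R) : 0 <= dot x x.
Proof. by apply: sumr_ge0 => i _; rewrite -expr2 sqr_ge0. Qed.

(** The exponential factors into its first coordinate and the rest, so induction on the dimension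
    reduces the claim to the Gauss integral on the line. *)
Lemma gaussian_integrable n :
  (leb R n).-integrable setT (EFin \o (fun t : n.-tuple R => expR (- dot t t))).
Proof.
have mg k : measurable_fun setT (EFin \o (fun t : k.-tuple R => expR (- dot t t))).
  apply/measurable_EFinP; apply: (measurableT_comp (@measurable_expR R)).
  by apply: measurable_funN; exact: measurable_dot.
apply/integrableP; split; first exact: mg.
under eq_integral do rewrite /= ger0_norm ?expR_ge0//.
elim: n => [|n IH].
  rewrite integral_dirac ?diracT ?mul1e//; last exact: mg.
  by rewrite ltry.
rewrite ge0_integral_lebS; [|exact: mg|by move=> t; rewrite lee_fin expR_ge0].
have E (x : measurableTypeR R) : (\int[leb R n]_t (expR (- dot (consp (x, t)) (consp (x, t))))%:E =
    (gauss_fun (x : R))%:E * \int[leb R n]_t (expR (- dot t t))%:E)%E.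
  rewrite -ge0_integralZl; [|by []|exact: mg|by move=> t _; rewrite lee_fin expR_ge0
    |by rewrite lee_fin gauss_fun_ge0].
  apply: eq_integral => t _; rewrite -EFinM -expRD; congr (expR _)%:E.
  rewrite /dot big_ord_recl /= !tnth0 opprD expr2; congr (_ - _).
  by apply: eq_bigr => i _; rewrite !tnthS.
under eq_integral do rewrite E.
rewrite ge0_integralZr; [|by []|by apply/measurable_EFinP; exact: measurable_gauss_fun
  |by move=> x _; rewrite lee_fin gauss_fun_ge0
  |by apply: integral_ge0 => t _; rewrite lee_fin expR_ge0].
rewrite integralT_gauss lte_mul_pinfty//.
Qed.

(** Cubes stand in for balls where only finiteness or positivity of a volume matters; the volume of
    a ball is never computed. *)
Definition box n (a b : R) : set (n.-tuple R) := [set t | forall i, a < tnth t i < b].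

Lemma measurable_box n a b : measurable (@box n a b).
Proof.
rewrite (_ : @box n a b = \bigcap_(i in [set: 'I_n])
    ((fun t : n.-tuple R => tnth t i) @^-1` `]a, b[%classic)); last first.
  apply/seteqP; split=> t h i; first by move=> _ /=; rewrite in_itv; exact: h.
  by have := h i I; rewrite /= in_itv.
apply: fin_bigcap_measurable => // i _.
by rewrite -[X in measurable X]setTI; apply: measurable_tnth.
Qed.

Lemma leb_box n a b : a < b -> leb R n (@box n a b) = ((b - a) ^+ n)%:E.
Proof.
move=> ab; elim: n => [|n IH].
  by rewrite expr0 /= diracE mem_set//; move=> [].
rewrite lebSE (_ : _ @^-1` _ = `]a, b[%classic `*` @box n a b); last first.
  apply/seteqP; split => -[x t] /=.
    move=> h; split; first by rewrite in_itv; have := h ord0; rewrite tnth0.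
    by move=> i; have := h (lift ord0 i); rewrite tnthS.
  rewrite in_itv => -[xab h] i.
  by have [j ->|->] := unliftP ord0 i; rewrite ?tnthS ?tnth0.
rewrite product_measure1E//; last exact: measurable_box.
by rewrite [X in (_ * X)%E]IH /= lebesgue_measure_itv/= lte_fin ab -EFinD -EFinM exprS.
Qed.

Lemma dotC n (x y : n.-tuple R) : dot x y = dot y x.
Proof. by apply: eq_bigr => i _; rewrite mulrC. Qed.

Lemma dot_cauchy_schwarz n (x y : n.-tuple R) : dot x y ^+ 2 <= dot x x * dot y y.
Proof.
have q (t : R) : 0 <= dot x x - 2 * t * dot x y + t ^+ 2 * dot y y.
  have -> : dot x x - 2 * t * dot x y + t ^+ 2 * dot y y =
      \sum_(i < n) (tnth x i - t * tnth y i) ^+ 2.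
    rewrite /dot !mulr_sumr -sumrB -big_split /=.
    by apply: eq_bigr => i _; ring.
  by apply: sumr_ge0 => i _; exact: sqr_ge0.
have [y0|yn0] := eqVneq (dot y y) 0.
  suff -> : dot x y = 0 by rewrite expr0n/= y0 mulr0.
  rewrite /dot big1// => i _.
  have : tnth y i * tnth y i = 0.
    move: y0 => /eqP; rewrite /dot psumr_eq0; last by move=> j _; rewrite -expr2 sqr_ge0.
    by move=> /allP/(_ i); rewrite mem_index_enum => /(_ isT)/eqP.
  by move=> /eqP; rewrite mulf_eq0 orbb => /eqP ->; rewrite mulr0.
have yp : 0 < dot y y by rewrite lt_def yn0 dot_ge0.
have := q (dot x y / dot y y).
rewrite -(pmulr_rge0 _ yp) -[_ <= dot x x * _]subr_ge0.
suff -> : dot y y * (dot x x - 2 * (dot x y / dot y y) * dot x y +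
    (dot x y / dot y y) ^+ 2 * dot y y) = dot x x * dot y y - dot x y ^+ 2 by [].
by field.
Qed.

End LebesgueTuple.

(** * The short-time Fourier transform *)

Section ComplexFubini.
Context d1 d2 (T1 : measurableType d1) (T2 : measurableType d2) (R : realType).
Variables (m1 : {sigma_finite_measure set T1 -> \bar R}).
Variables (m2 : {sigma_finite_measure set T2 -> \bar R}).

(** Tonelli gives measurability of the integrals of the positive and the negative part separately;
    subtraction in the extended reals and [fine] preserve it. *)
Lemma measurable_Rintegral (h : T1 * T2 -> R) : measurable_fun setT h ->
  measurable_fun setT (fun x => \int[m2]_y h (x, y)).
Proof.
move=> mh; apply: (measurableT_comp (fine_measurable measurableT)).
have mh' : measurable_fun setT (EFin \o h) by exact/measurable_EFinP.
under eq_fun do rewrite integralE.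
apply: emeasurable_funB.
- have := @measurable_fun_fubini_tonelli_F _ _ _ _ _ m2 (EFin \o h)^\+%E.
  move=> /(_ (measurable_funepos mh') (fun=> funepos_ge0 _ _)).
  by congr (measurable_fun _ _); apply/funext => x; apply: eq_integral => y _; rewrite !funeposE.
- have := @measurable_fun_fubini_tonelli_F _ _ _ _ _ m2 (EFin \o h)^\-%E.
  move=> /(_ (measurable_funeneg mh') (fun=> funeneg_ge0 _ _)).
  by congr (measurable_fun _ _); apply/funext => x; apply: eq_integral => y _; rewrite !funenegE.
Qed.

(** The slices are integrable at every point, not just almost everywhere, so that [fine] loses
    nothing in the inner integrals. *)
Lemma Rintegral_Fubini (h : T1 * T2 -> R) : (m1 \x m2)%E.-integrable setT (EFin \o h) ->
  (forall x, m2.-integrable setT (EFin \o (fun y => h (x, y)))) ->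
  (forall y, m1.-integrable setT (EFin \o (fun x => h (x, y)))) ->
  \int[m1]_x (\int[m2]_y h (x, y)) = \int[m2]_y (\int[m1]_x h (x, y)).
Proof.
move=> ih ihx ihy; rewrite /Rintegral; congr fine.
transitivity (\int[m1]_x \int[m2]_y (h (x, y))%:E)%E.
  by apply: eq_integral => x _; rewrite fineK//; exact: (integrable_fin_num measurableT (ihx x)).
rewrite (Fubini ih).
by apply: eq_integral => y _; rewrite fineK//; exact: (integrable_fin_num measurableT (ihy y)).
Qed.

Lemma cintegral_Fubini (h : T1 * T2 -> R[i]) : cint (m1 \x m2)%E h ->
  (forall x, cint m2 (fun y => h (x, y))) ->
  (forall y, cint m1 (fun x => h (x, y))) ->
  cintegral m1 (fun x => cintegral m2 (fun y => h (x, y))) =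
  cintegral m2 (fun y => cintegral m1 (fun x => h (x, y))).
Proof.
move=> [ihr ihi] hx hy; apply: complex_eq => /=.
- by apply: (Rintegral_Fubini ihr) => [x|y]; [have [] := hx x|have [] := hy y].
- by apply: (Rintegral_Fubini ihi) => [x|y]; [have [] := hx x|have [] := hy y].
Qed.

Lemma integrable_tensor (f : T1 -> R) (g : T2 -> R) :
  m1.-integrable setT (EFin \o f) -> m2.-integrable setT (EFin \o g) ->
  (forall x, 0 <= f x) -> (forall x, 0 <= g x) ->
  (m1 \x m2)%E.-integrable setT (EFin \o (fun z => f z.1 * g z.2)).
Proof.
move=> fi gi f0 g0.
have mf := measurable_int m1 fi; have mg := measurable_int m2 gi.
have mfg : measurable_fun setT (EFin \o (fun z : T1 * T2 => f z.1 * g z.2)).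
  apply/measurable_EFinP; apply: measurable_funM.
    by apply: (measurableT_comp (f := f)) => //; exact/measurable_EFinP.
  by apply: (measurableT_comp (f := g)) => //; exact/measurable_EFinP.
apply/(integrable12ltyP m1 m2 mfg).
have E x : (\int[m2]_y `|(EFin \o (fun z : T1 * T2 => (f z.1 * g z.2)%R)) (x, y)| =
   (f x)%:E * \int[m2]_y (g y)%:E)%E.
  rewrite -ge0_integralZl//; [|by move=> y _; rewrite lee_fin|by rewrite lee_fin].
  apply: eq_integral => y _ /=; rewrite ger0_norm ?EFinM//; exact: mulr_ge0.
under eq_integral do rewrite E.
rewrite ge0_integralZr//; [|by move=> x _; rewrite lee_fin
  |by apply: integral_ge0 => y _; rewrite lee_fin].
apply: lte_mul_pinfty.
- by apply: integral_ge0 => x _; rewrite lee_fin.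
- exact: (integrable_fin_num measurableT fi).
- exact: (integrable_lty measurableT gi).
Qed.

End ComplexFubini.

(** * Atoms, their Gaussian majorants and bounds on inner products *)

Section AnalysisOperator.
Context {R : realType} {d : nat}.
Local Notation Rd := (d.-tuple R).
Local Notation R2d := (d.-tuple R * d.-tuple R)%type.
Local Notation mu := (leb R d).
Local Notation lam := (@leb2 R d).
Implicit Types (x y : Rd) (z : R2d) (f g e : Rd -> R[i]).

Definition window x : R := 2 `^ (d%:R / 4) * expR (- pi * dot x x).

Definition atom z y : R[i] := gaussian (subt y z.1) * expi (2 * pi * dot z.2 y).

Lemma window_ge0 x : 0 <= window x.
Proof. by rewrite mulr_ge0 ?expR_ge0// powR_ge0. Qed.

Lemma sqn_expi (t : R) : sqn (expi t) = 1.
Proof. by rewrite /sqn /= cos2Dsin2. Qed.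

Lemma expiD (s t : R) : expi (s + t) = expi s * expi t.
Proof. by apply: complex_eq; rewrite !reimE/= ?cosD ?sinD//; ring. Qed.

Lemma conj_expi (t : R) : conjc (expi t) = expi (- t).
Proof. by rewrite /expi cosN sinN. Qed.

Lemma stftE f z : stft f z = inner mu f (atom z).
Proof.
apply: eq_cintegral => y; rewrite /atom conj_mul mulrA; congr (_ * _).
by rewrite conj_expi.
Qed.

Lemma re_atom z y : re (atom z y) = window (subt y z.1) * cos (2 * pi * dot z.2 y).
Proof. by rewrite !reimE/= mul0r subr0. Qed.

Lemma im_atom z y : im (atom z y) = window (subt y z.1) * sin (2 * pi * dot z.2 y).
Proof. by rewrite !reimE/= mul0r addr0. Qed.

Lemma sqn_atom z y : sqn (atom z y) = window (subt y z.1) ^+ 2.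
Proof. by rewrite sqnM sqn_expi mulr1 sqn_real. Qed.

(** Common majorant in [y], up to constants, of all windows centred at bounded positions. Being at
    most 1 it dominates its own square, so bounds on values and on squares use the same function. *)
Definition decay y : R := expR (- dot y y).

Lemma decay_ge0 y : 0 <= decay y. Proof. exact: expR_ge0. Qed.
Lemma decay_le1 y : decay y <= 1.
Proof. by rewrite -expR0 ler_expR oppr_le0 dot_ge0. Qed.
Lemma decay_sqr_le y : decay y ^+ 2 <= decay y.
Proof. by rewrite expr2 ler_piMr ?decay_ge0// decay_le1. Qed.

Lemma decay_integrable : mu.-integrable setT (EFin \o decay).
Proof. exact: gaussian_integrable. Qed.

Lemma dot_subt y x : dot (subt y x) (subt y x) = dot y y - 2 * dot y x + dot x x.
Proof.
rewrite /dot mulr_sumr -sumrB -big_split/=.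
by apply: eq_bigr => i _; rewrite !tnth_mktuple; ring.
Qed.

Lemma dot_le_subt y x : dot y y <= 2 * dot (subt y x) (subt y x) + 2 * dot x x.
Proof.
(* The right-hand side minus the left-hand side is |y - 2x|^2. *)
have : 0 <= \sum_(i < d) (tnth y i - 2 * tnth x i) ^+ 2.
  by apply: sumr_ge0 => i _; exact: sqr_ge0.
have -> : \sum_(i < d) (tnth y i - 2 * tnth x i) ^+ 2 = dot y y - 4 * dot y x + 4 * dot x x.
  rewrite /dot !mulr_sumr -sumrB -big_split/=.
  by apply: eq_bigr => i _; ring.
by rewrite dot_subt; lra.
Qed.

Definition window_cst (rho : R) : R := 2 `^ (d%:R / 4) * expR (2 * rho).

Lemma window_cst_ge0 rho : 0 <= window_cst rho.
Proof. by rewrite mulr_ge0 ?expR_ge0// powR_ge0. Qed.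

(** Since |y|^2 <= 2|y - x|^2 + 2|x|^2 and pi >= 2, the exponent -pi|y - x|^2 is at most -|y|^2 + 2
    rho; this is the origin of [expR (2 * rho)] in [window_cst]. *)
Lemma window_le rho x y : dot x x <= rho -> window (subt y x) <= window_cst rho * decay y.
Proof.
move=> xr; rewrite -mulrA -expRD ler_wpM2l ?powR_ge0// ler_expR.
have := dot_le_subt y x; have := pi_ge2 R; have := dot_ge0 (subt y x).
by move=> ? ? ?; nra.
Qed.

Lemma re_atom_le rho z y : dot z.1 z.1 <= rho -> `|re (atom z y)| <= window_cst rho * decay y.
Proof.
move=> /window_le; move=> /(_ y); apply: le_trans; rewrite re_atom normrM.
rewrite (ger0_norm (window_ge0 _)) ler_piMr ?window_ge0// ler_norml cos_geN1 cos_le1//.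
Qed.

Lemma im_atom_le rho z y : dot z.1 z.1 <= rho -> `|im (atom z y)| <= window_cst rho * decay y.
Proof.
move=> /window_le; move=> /(_ y); apply: le_trans; rewrite im_atom normrM.
rewrite (ger0_norm (window_ge0 _)) ler_piMr ?window_ge0// ler_norml sin_geN1 sin_le1//.
Qed.

Lemma measurable_subt dd (T : measurableType dd) (f g : T -> Rd) :
  measurable_fun setT f -> measurable_fun setT g ->
  measurable_fun setT (fun t => subt (f t) (g t)).
Proof.
move=> mf mg; apply/measurable_fun_tnthP => i.
rewrite (_ : _ \o _ = fun t => tnth (f t) i - tnth (g t) i); last first.
  by apply/funext => t /=; rewrite tnth_mktuple.
by apply: measurable_funB; apply: (measurableT_comp (measurable_tnth i)).
Qed.

Lemma cmeas_atom dd (T : measurableType dd) (f : T -> R2d) (g : T -> Rd) :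
  measurable_fun setT f -> measurable_fun setT g -> cmeas (fun t => atom (f t) (g t)).
Proof.
move=> mf mg.
have m1 : measurable_fun setT (fun t => (f t).1) by exact: (measurableT_comp measurable_fst).
have m2 : measurable_fun setT (fun t => (f t).2) by exact: (measurableT_comp measurable_snd).
have ms := measurable_subt mg m1.
have md := measurable_dot m2 mg.
have mw : measurable_fun setT (fun t => window (subt (g t) (f t).1)).
  apply: measurable_funM => //; apply: (measurableT_comp (@measurable_expR R)).
  by apply: measurable_funM => //; exact: measurable_dot.
have mp : measurable_fun setT (fun t => 2 * pi * dot (f t).2 (g t)).
  exact: measurable_funM.
split.
- under eq_fun do rewrite re_atom; apply: measurable_funM => //.
  by apply: (measurableT_comp (f := @cos R)) => //; apply: continuous_measurable_fun; exact: continuous_cos.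
- under eq_fun do rewrite im_atom; apply: measurable_funM => //.
  by apply: (measurableT_comp (f := @sin R)) => //; apply: continuous_measurable_fun; exact: continuous_sin.
Qed.

Lemma sqn_atom_le rho z y : dot z.1 z.1 <= rho ->
  sqn (atom z y) <= window_cst rho ^+ 2 * decay y.
Proof.
move=> zr; rewrite sqn_atom.
apply: (@le_trans _ _ ((window_cst rho * decay y) ^+ 2)).
  by rewrite lerXn2r ?nnegrE ?window_ge0 ?mulr_ge0 ?window_cst_ge0 ?decay_ge0// window_le.
by rewrite exprMn ler_wpM2l ?sqr_ge0// decay_sqr_le.
Qed.

Lemma L2_atom z : L2 mu (atom z).
Proof.
apply: (@L2_le _ _ _ _ _ (fun y => window_cst (dot z.1 z.1) ^+ 2 * decay y)).
- by apply: (cmeas_atom (f := fun=> z) (g := id)).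
- by apply: integrableRZ; exact: decay_integrable.
- by move=> y; exact: sqn_atom_le.
Qed.

Lemma nrm_atom_le rho z : dot z.1 z.1 <= rho ->
  nrm mu (atom z) <= window_cst rho ^+ 2 * \int[mu]_y decay y.
Proof.
move=> zr; rewrite -RintegralZl//; last exact: decay_integrable.
apply: Rintegral_mono.
- exact: L2_int (L2_atom z).
- by apply: integrableRZ; exact: decay_integrable.
- by move=> y; exact: sqn_atom_le.
Qed.

Lemma cmeas_stft f : cmeas f -> cmeas (stft f).
Proof.
move=> mf.
have mfa : cmeas (fun p : R2d * Rd => f p.2 * conjc (atom p.1 p.2)).
  apply: cmeasM.
    have [m1 m2] := mf.
    by split; [exact: (measurableT_comp m1 measurable_snd)|exact: (measurableT_comp m2 measurable_snd)].
  by apply: cmeas_conj; apply: cmeas_atom.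
have [mr mi] := mfa.
split.
- by under eq_fun do rewrite stftE; exact: (measurable_Rintegral mu mr).
- by under eq_fun do rewrite stftE; exact: (measurable_Rintegral mu mi).
Qed.

(** A crude form of Cauchy-Schwarz, from the arithmetic-geometric mean inequality under the
    integral. It serves to bound [stft f] uniformly over bounded positions. *)
Lemma re_inner_le f g : L2 mu f -> L2 mu g ->
  `|re (inner mu f g)| <= 2^-1 * (nrm mu f + nrm mu g).
Proof.
move=> Lf Lg; have [ir ii] := cint_inner Lf Lg.
rewrite -RintegralD//; [|exact: L2_int..].
rewrite -RintegralZl//; last by apply: integrableRD; exact: L2_int.
apply: le_trans (le_normr_Rintegral measurableT ir) _.
apply: Rintegral_mono.
- exact: (integrable_norm ir).
- by apply: integrableRZ; apply: integrableRD; exact: L2_int.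
- by move=> y; rewrite [leRHS]mulrC -(sqn_conj (g y)) re_mul_le.
Qed.

Lemma im_inner_le f g : L2 mu f -> L2 mu g ->
  `|im (inner mu f g)| <= 2^-1 * (nrm mu f + nrm mu g).
Proof.
move=> Lf Lg; have [ir ii] := cint_inner Lf Lg.
rewrite -RintegralD//; [|exact: L2_int..].
rewrite -RintegralZl//; last by apply: integrableRD; exact: L2_int.
apply: le_trans (le_normr_Rintegral measurableT ii) _.
apply: Rintegral_mono.
- exact: (integrable_norm ii).
- by apply: integrableRZ; apply: integrableRD; exact: L2_int.
- by move=> y; rewrite [leRHS]mulrC -(sqn_conj (g y)) im_mul_le.
Qed.

End AnalysisOperator.

Arguments window_cst {R} d rho.

(** * Localization operators as integrals of rank-one operators *)

Lemma sigma_finite_leb2 (R : realType) (d : nat) : sigma_finite setT (@leb2 R d).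
Proof.
have /sigma_finiteP[F [TF ndF Foo]] := sigma_finiteT (leb R d).
exists (fun i => F i `*` F i) => [|i].
  apply/seteqP; split=> // -[x y] _.
  have [[i _ Fi] [j _ Fj]] : (\bigcup_i F i) x /\ (\bigcup_i F i) y by rewrite -TF.
  exists (maxn i j) => //; split.
    by move: Fi; exact/subsetPset/ndF/leq_maxl.
  by move: Fj; exact/subsetPset/ndF/leq_maxr.
have [mF Fi] := Foo i; split; first exact: measurableX.
have -> : @leb2 R d (F i `*` F i) = (leb R d (F i) * leb R d (F i))%E.
  exact: product_measure1E.
by apply: lte_mul_pinfty => //; rewrite ge0_fin_numE.
Qed.

(** [leb2] is declared as a mere measure. The same function is repackaged here with its
    sigma-finiteness, which the Fubini lemmas demand. *)
Definition leb2_sigma_finite (R : realType) (d : nat) :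
    {sigma_finite_measure set (d.-tuple R * d.-tuple R)%type -> \bar R} :=
  HB.pack_for {sigma_finite_measure set (d.-tuple R * d.-tuple R)%type -> \bar R}
    (Measure.sort (@leb2 R d)) (Measure.class (@leb2 R d))
    (Measure_isSigmaFinite.Build _ _ _ _ (@sigma_finite_leb2 R d)).

Section LocalizationOperator.
Context {R : realType} {d : nat}.
Local Notation Rd := (d.-tuple R).
Local Notation R2d := (d.-tuple R * d.-tuple R)%type.
Local Notation mu := (leb R d).
Local Notation lam := (@leb2 R d).
Implicit Types (y : Rd) (z : R2d) (f g e : Rd -> R[i]).

(** The synthesis integral of the truncated transform, evaluated pointwise: an explicit
    representative for the abstractly chosen [loc_op]. *)
Definition loc_integral (Omega : set R2d) f y : R[i] :=
  cintegral lam (fun z => (\1_Omega z)%:C%C * stft f z * atom z y).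

Variables (Omega : set R2d) (rho : R).
Hypothesis mOmega : measurable Omega.
Hypothesis Omega_fin : (lam Omega < +oo)%E.
Hypothesis Omega_bnd : forall z, Omega z -> dot z.1 z.1 <= rho.

(** Depends on the position bound [rho] but not on the frequency, hence is the same for all shears
    of a set. *)
Definition stft_cst f := 2^-1 * (nrm mu f + window_cst d rho ^+ 2 * \int[mu]_y decay y).

Lemma re_stft_le f z : L2 mu f -> dot z.1 z.1 <= rho -> `|re (stft f z)| <= stft_cst f.
Proof.
move=> Lf zr; rewrite stftE; apply: le_trans (re_inner_le Lf (L2_atom z)) _.
by rewrite ler_wpM2l ?invr_ge0// lerD2l nrm_atom_le.
Qed.

Lemma im_stft_le f z : L2 mu f -> dot z.1 z.1 <= rho -> `|im (stft f z)| <= stft_cst f.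
Proof.
move=> Lf zr; rewrite stftE; apply: le_trans (im_inner_le Lf (L2_atom z)) _.
by rewrite ler_wpM2l ?invr_ge0// lerD2l nrm_atom_le.
Qed.

Lemma stft_cst_ge0 f : 0 <= stft_cst f.
Proof.
rewrite mulr_ge0 ?invr_ge0// addr_ge0 ?nrm_ge0// mulr_ge0 ?sqr_ge0//.
by apply: Rintegral_ge0 => y _; exact: decay_ge0.
Qed.

Definition loc_cst f := 2 * stft_cst f * window_cst d rho.

Lemma loc_cst_ge0 f : 0 <= loc_cst f.
Proof. by rewrite mulr_ge0 ?window_cst_ge0 // mulr_ge0 // stft_cst_ge0. Qed.

Lemma stft_atom_le f z y : L2 mu f -> dot z.1 z.1 <= rho ->
  `|re (stft f z * atom z y)| <= loc_cst f * decay y /\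
  `|im (stft f z * atom z y)| <= loc_cst f * decay y.
Proof.
move=> Lf zr.
have a1 := re_stft_le Lf zr; have a2 := im_stft_le Lf zr.
have b1 := re_atom_le y zr; have b2 := im_atom_le y zr.
have -> : loc_cst f * decay y = stft_cst f * (window_cst d rho * decay y) +
   stft_cst f * (window_cst d rho * decay y) by rewrite /loc_cst; ring.
split; rewrite !reimE; (apply: le_trans (ler_normD _ _) _);
  by rewrite ?normrN !normrM; apply: lerD; apply: ler_pM.
Qed.

Lemma loc_integrand_le f z y : L2 mu f ->
  `|re ((\1_Omega z)%:C%C * stft f z * atom z y)| <= \1_Omega z * (loc_cst f * decay y) /\
  `|im ((\1_Omega z)%:C%C * stft f z * atom z y)| <= \1_Omega z * (loc_cst f * decay y).
Proof.
move=> Lf; rewrite -mulrA indicE; have [zO|zO] := boolP (z \in Omega).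
  rewrite (_ : (true%:R%:C)%C = 1)// !mul1r.
  by apply: stft_atom_le => //; apply: Omega_bnd; exact: set_mem.
by rewrite (_ : (false%:R%:C)%C = 0)// !mul0r normr0.
Qed.

Lemma cmeas_loc_integrand f dd (T : measurableType dd) (a : T -> R2d) (b : T -> Rd) :
  L2 mu f -> measurable_fun setT a -> measurable_fun setT b ->
  cmeas (fun t => (\1_Omega (a t))%:C%C * stft f (a t) * atom (a t) (b t)).
Proof.
move=> Lf ma mb; apply: cmeasM; last exact: cmeas_atom.
apply: cmeasM.
  apply: cmeas_real; apply: (measurableT_comp (f := \1_Omega : R2d -> R)) => //.
have [m1 m2] := cmeas_stft (L2_cmeas Lf).
by split; [exact: (measurableT_comp m1 ma)|exact: (measurableT_comp m2 ma)].
Qed.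

Lemma indicZ_integrable (c : R) : lam.-integrable setT (EFin \o (fun z => \1_Omega z * c)).
Proof.
under eq_fun do rewrite mulrC; apply: integrableRZ.
exact: integrable_indic_fin.
Qed.

Lemma cint_loc_integrand f y : L2 mu f ->
  cint lam (fun z => (\1_Omega z)%:C%C * stft f z * atom z y).
Proof.
move=> Lf; apply: (@cint_le _ _ _ _ _ (fun z => \1_Omega z * (loc_cst f * decay y))).
- by apply: (cmeas_loc_integrand (a := id) (b := fun=> y)) => //; exact: measurable_cst.
- exact: indicZ_integrable.
- by move=> z; have [] := loc_integrand_le z y Lf.
- by move=> z; have [] := loc_integrand_le z y Lf.
Qed.

Lemma loc_integral_le f y : L2 mu f ->
  `|re (loc_integral Omega f y)| <= loc_cst f * fine (lam Omega) * decay y /\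
  `|im (loc_integral Omega f y)| <= loc_cst f * fine (lam Omega) * decay y.
Proof.
move=> Lf; have [ir ii] := cint_loc_integrand y Lf.
have -> : loc_cst f * fine (lam Omega) * decay y =
    \int[lam]_z (\1_Omega z * (loc_cst f * decay y)).
  under eq_Rintegral do rewrite mulrC.
  rewrite RintegralZl//; last exact: integrable_indic_fin.
  rewrite /Rintegral integral_indic// setIT; ring.
split.
- apply: le_trans (le_normr_Rintegral measurableT ir) _.
  apply: Rintegral_mono; [exact: integrable_norm ir|exact: indicZ_integrable|].
  by move=> z; have [] := loc_integrand_le z y Lf.
- apply: le_trans (le_normr_Rintegral measurableT ii) _.
  apply: Rintegral_mono; [exact: integrable_norm ii|exact: indicZ_integrable|].
  by move=> z; have [] := loc_integrand_le z y Lf.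
Qed.

Lemma cmeas_loc_integral f : L2 mu f -> cmeas (loc_integral Omega f).
Proof.
move=> Lf.
have [mr mi] := @cmeas_loc_integrand f _ (Rd * R2d)%type snd fst Lf measurable_snd measurable_fst.
by split; [exact: (measurable_Rintegral (leb2_sigma_finite R d) mr)
  |exact: (measurable_Rintegral (leb2_sigma_finite R d) mi)].
Qed.

Lemma sqn_le (x : R[i]) (c : R) : `|re x| <= c -> `|im x| <= c -> sqn x <= 2 * c ^+ 2.
Proof.
move=> xr xi; have c0 : 0 <= c by exact: le_trans xr.
have sq (a : R) : `|a| <= c -> a ^+ 2 <= c ^+ 2.
  by move=> ac; rewrite -real_normK ?num_real// lerXn2r ?nnegrE.
by rewrite /sqn mulr_natl mulr2n lerD// sq.
Qed.

Lemma sqn_decay_le (x : R[i]) (c : R) y : 0 <= c -> `|re x| <= c * decay y ->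
  `|im x| <= c * decay y -> sqn x <= 2 * c ^+ 2 * decay y.
Proof.
move=> c0 xr xi; apply: le_trans (sqn_le xr xi) _.
by rewrite exprMn mulrA ler_wpM2l ?decay_sqr_le// mulr_ge0// sqr_ge0.
Qed.

Lemma L2_loc_integral f : L2 mu f -> L2 mu (loc_integral Omega f).
Proof.
move=> Lf; apply: (@L2_le _ _ _ _ _
    (fun y => 2 * (loc_cst f * fine (lam Omega)) ^+ 2 * decay y)).
- exact: cmeas_loc_integral.
- by apply: integrableRZ; exact: decay_integrable.
- move=> y; have [h1 h2] := loc_integral_le y Lf; apply: sqn_decay_le => //.
  by rewrite mulr_ge0 ?loc_cst_ge0// fine_ge0.
Qed.

(** Fubini for the integrand [h] on phase space times configuration space, after writing [stft g] as
    an inner product with atoms. *)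
Lemma loc_integral_adjoint f g : L2 mu f -> L2 mu g ->
  inner mu (loc_integral Omega f) g =
  inner lam (fun z => (\1_Omega z)%:C%C * stft f z) (stft g).
Proof.
move=> Lf Lg.
pose h (p : R2d * Rd) := ((\1_Omega p.1)%:C%C * stft f p.1 * atom p.1 p.2) * conjc (g p.2).
have mg := L2_cmeas Lg.
have mh : cmeas h.
  apply: cmeasM; first by apply: (cmeas_loc_integrand (a := fst) (b := snd)).
  apply: cmeas_conj; have [m1 m2] := mg.
  by split; [exact: (measurableT_comp m1 measurable_snd)|exact: (measurableT_comp m2 measurable_snd)].
pose c : R := 2 * loc_cst f ^+ 2.
have c0 : 0 <= c by rewrite mulr_ge0 ?sqr_ge0.
(* The product with [g] is dominated by the mean of two squares: [c * decay] bounds the squared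
   modulus of the first factor. The majorant [\1_Omega z * k y] separates the variables. *)
pose k y := 2^-1 * (c * decay y + sqn (g y)).
have ik : mu.-integrable setT (EFin \o k).
  apply: integrableRZ; apply: integrableRD; last exact: L2_int.
  by apply: integrableRZ; exact: decay_integrable.
have k0 y : 0 <= k y.
  by rewrite mulr_ge0 ?invr_ge0// addr_ge0 ?sqn_ge0// mulr_ge0 ?decay_ge0.
have hk p : `|re (h p)| <= \1_Omega p.1 * k p.2 /\ `|im (h p)| <= \1_Omega p.1 * k p.2.
  have [h1 h2] := loc_integrand_le p.1 p.2 Lf.
  rewrite /h; move: h1 h2; rewrite indicE.
  have [pO|pO] := boolP (p.1 \in Omega); last first.
    by rewrite (_ : (false%:R%:C)%C = 0)// !mul0r normr0.
  rewrite (_ : true%:R = 1 :> R)// (_ : (1%:C)%C = 1)// !mul1r => h1 h2.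
  have h3 := sqn_decay_le (loc_cst_ge0 f) h1 h2.
  split;  [apply: le_trans (re_mul_le _ _) _|apply: le_trans (im_mul_le _ _) _];
    by rewrite sqn_conj mulrC ler_wpM2l ?invr_ge0// lerD2r.
have ih : cint (lam \x mu)%E h.
  apply: (@cint_le _ _ _ _ _ (fun p => \1_Omega p.1 * k p.2)) => //.
  - apply: (@integrable_tensor _ _ _ _ _ (leb2_sigma_finite R d) mu (\1_Omega) k) => //.
    exact: integrable_indic_fin.
  - by move=> p; have [] := hk p.
  - by move=> p; have [] := hk p.
have hz z : cint mu (fun y => h (z, y)).
  apply: (@cint_le _ _ _ _ _ (fun y => \1_Omega z * k y)).
  - apply: cmeasM; last exact: cmeas_conj.
    by apply: (cmeas_loc_integrand (a := fun=> z) (b := id)) => //; exact: measurable_cst.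
  - exact: integrableRZ.
  - by move=> y; have [] := hk (z, y).
  - by move=> y; have [] := hk (z, y).
have hy y : cint lam (fun z => h (z, y)).
  apply: (@cint_le _ _ _ _ _ (fun z => \1_Omega z * k y)).
  - apply: cmeasM; last exact: (@cmeas_cst _ _ R (conjc (g y))).
    by apply: (cmeas_loc_integrand (a := id) (b := fun=> y)) => //; exact: measurable_cst.
  - exact: indicZ_integrable.
  - by move=> z; have [] := hk (z, y).
  - by move=> z; have [] := hk (z, y).
transitivity (cintegral mu (fun y => cintegral lam (fun z => h (z, y)))).
  apply: eq_cintegral => y; rewrite mulrC -cintegralZ; last exact: cint_loc_integrand.
  by apply: eq_cintegral => z; rewrite mulrC.
rewrite -(@cintegral_Fubini _ _ _ _ _ (leb2_sigma_finite R d) mu h ih hz hy).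
apply: eq_cintegral => z; rewrite (stftE g) -inner_conj//; last exact: L2_atom.
rewrite -cintegralZ; last by apply: cint_inner => //; exact: L2_atom.
by apply: eq_cintegral => y; rewrite /h mulrA.
Qed.

(** [loc_op] comes from [xget] and is known only through its inner products. That determines its
    norm: with h the chosen function and T the explicit one, <h, h> = <T, h>, the conjugate of <h,
    T> = <T, T>. *)
Lemma L2norm2_loc_op f : L2 mu f ->
  L2norm2 mu (loc_op Omega f) = (nrm mu (loc_integral Omega f))%:E.
Proof.
move=> Lf; have LT := L2_loc_integral Lf.
pose P := [set h | L2 mu h /\ forall g, L2 mu g -> inner mu h g =
   inner lam (fun z => (\1_Omega z)%:C%C * stft f z) (stft g)].
have [Lh hP] : P (loc_op Omega f).
  apply: (@xgetPex _ (fun=> 0) P); exists (loc_integral Omega f); split => //.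
  by move=> g Lg; exact: loc_integral_adjoint.
rewrite L2norm2_fin//; congr EFin.
have E g : L2 mu g -> inner mu (loc_op Omega f) g = inner mu (loc_integral Omega f) g.
  by move=> Lg; rewrite hP// loc_integral_adjoint.
rewrite -[LHS]re_inner_self// E// inner_conj// re_conj E//.
exact: re_inner_self.
Qed.

End LocalizationOperator.

(** * Shears *)

Lemma sin_norm_le {R : realType} (t : R) : `|sin t| <= `|t|.
Proof.
wlog t0 : t / 0 < t.
  move=> h; have [/h//|t0|t0] := ltgtP 0 t; last by rewrite -t0 sin0.
  by rewrite -normrN -sinN -(normrN t); apply: h; rewrite oppr_gt0.
have [c _] := MVT t0 (fun x _ => is_derive_sin x) (continuous_subspaceT (@continuous_sin R)).
by rewrite sin0 !subr0 => ->; rewrite normrM ler_piMl// cos_max.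
Qed.

(** By the half-angle formula 1 - cos t = 2 sin^2(t/2). The quadratic order in the shear parameter
    originates here. *)
Lemma cos_lower {R : realType} (t : R) : 0 <= 1 - cos t <= t ^+ 2 / 2.
Proof.
rewrite subr_ge0 cos_le1 /=.
have -> : t = (t / 2) *+ 2 by rewrite -mulr_natr divfK.
rewrite cos_mulr2n cos2sin2 mulr2n.
have : sin (t / 2) ^+ 2 <= (t / 2) ^+ 2.
  by rewrite -(real_normK (num_real (sin _))) -(real_normK (num_real (t / 2)))
    lerXn2r ?nnegrE// sin_norm_le.
by move=> h; nra.
Qed.

Section SqnCintegral.
Context d (T : measurableType d) (R : realType) (mu : {measure set T -> \bar R}).

Lemma integrable_indic_bounded (A : set T) (w : T -> R) (c : R) : measurable A ->
  (mu A < +oo)%E -> measurable_fun setT w -> (forall x, A x -> `|w x| <= c) ->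
  mu.-integrable setT (EFin \o (fun x => \1_A x * w x)).
Proof.
move=> mA Aoo mw wc; apply: (@integrable_le _ _ _ _ _ (fun x => c * \1_A x)).
- exact: measurable_funM.
- by apply: integrableRZ; exact: integrable_indic_fin.
- move=> x; rewrite indicE; have [/set_mem/wc|_] := boolP (x \in A).
    by rewrite (_ : true%:R = 1 :> R)// mul1r mulr1.
  by rewrite mul0r mulr0 normr0.
Qed.

Lemma re_realM (a : R) (x : R[i]) : re (a%:C%C * x) = a * re x.
Proof. by rewrite !reimE/= mul0r subr0. Qed.

Lemma im_realM (a : R) (x : R[i]) : im (a%:C%C * x) = a * im x.
Proof. by rewrite !reimE/= mul0r addr0. Qed.

Lemma cint_indic_bounded (A : set T) (w : T -> R[i]) (c : R) : measurable A ->
  (mu A < +oo)%E -> cmeas w -> (forall x, A x -> `|re (w x)| <= c /\ `|im (w x)| <= c) ->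
  cint mu (fun x => (\1_A x)%:C%C * w x).
Proof.
move=> mA Aoo [mr mi] wc; split.
- under eq_fun do rewrite re_realM.
  by apply: (integrable_indic_bounded (c := c)) => // x /wc[].
- under eq_fun do rewrite im_realM.
  by apply: (integrable_indic_bounded (c := c)) => // x /wc[].
Qed.

Lemma sqr_bounded_integrable (A : set T) (w : T -> R) (c : R) : measurable A ->
  (mu A < +oo)%E -> measurable_fun setT w -> (forall x, A x -> `|w x| <= c) ->
  mu.-integrable setT (EFin \o (fun x => \1_A x * w x ^+ 2)).
Proof.
move=> mA Aoo mw wc; apply: (integrable_indic_bounded (c := c ^+ 2)) => //.
  exact: measurable_funX.
move=> x /wc wxc; rewrite normrX lerXn2r ?nnegrE//.
exact: le_trans wxc.
Qed.

(** Cauchy-Schwarz on a set of finite measure, applied to real and imaginary parts. The bound [c]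
    secures integrability and does not enter the estimate. *)
Lemma sqn_cintegral_le (A : set T) (w : T -> R[i]) (c v : R) : measurable A ->
  mu A = v%:E -> 0 < v -> cmeas w ->
  (forall x, A x -> `|re (w x)| <= c /\ `|im (w x)| <= c) ->
  mu.-integrable setT (EFin \o (fun x => \1_A x * sqn (w x))) /\
  sqn (cintegral mu (fun x => (\1_A x)%:C%C * w x)) <= v * \int[mu]_x (\1_A x * sqn (w x)).
Proof.
move=> mA Av v0 [mr mi] wc.
have Aoo : (mu A < +oo)%E by rewrite Av ltry.
have wr x : A x -> `|re (w x)| <= c by move=> /wc[].
have wi x : A x -> `|im (w x)| <= c by move=> /wc[].
have r1 := integrable_indic_bounded mA Aoo mr wr.
have i1 := integrable_indic_bounded mA Aoo mi wi.
have r2 := sqr_bounded_integrable mA Aoo mr wr.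
have i2 := sqr_bounded_integrable mA Aoo mi wi.
have E : (fun x => \1_A x * sqn (w x)) = (fun x => \1_A x * re (w x) ^+ 2 + \1_A x * im (w x) ^+ 2).
  by apply/funext => x; rewrite mulrDr.
rewrite E; split; first exact: integrableRD.
rewrite RintegralD// mulrDr /sqn /=.
under eq_Rintegral do rewrite re_realM.
under [X in _ + X ^+ 2 <= _]eq_Rintegral do rewrite im_realM.
by apply: lerD; exact: sqr_Rintegral_le.
Qed.

Lemma cintegral_preserving (phi : T -> T) (h : T -> R[i]) : measure_preserving mu phi ->
  cmeas h -> cintegral mu (fun x => h (phi x)) = cintegral mu h.
Proof.
by move=> mp [mr mi]; apply: complex_eq;
  [exact: (Rintegral_preserving mp mr)|exact: (Rintegral_preserving mp mi)].
Qed.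

End SqnCintegral.

Section Shear.
Context {R : realType} {d : nat}.
Local Notation Rd := (d.-tuple R).
Local Notation R2d := (d.-tuple R * d.-tuple R)%type.
Local Notation mu := (leb R d).
Local Notation lam := (@leb2 R d).
Implicit Types (y : Rd) (z : R2d) (f g e : Rd -> R[i]) (s : R).

Definition scale s (x : Rd) : Rd := [tuple s * tnth x i | i < d].

(** Written with [affine_tuple 1] so that each fibre map is a translation, to which
    [skew_product_preserving] applies. *)
Definition shear s z : R2d := (z.1, affine_tuple 1 (scale s z.1) z.2).

Lemma shearE2 s z i : tnth (shear s z).2 i = tnth z.2 i + s * tnth z.1 i.
Proof. by rewrite !tnth_mktuple mul1r. Qed.

Lemma shear_cancel s t z : s + t = 0 -> shear s (shear t z) = z.
Proof.
move=> st; rewrite [RHS]surjective_pairing; congr pair.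
apply: eq_from_tnth => i; rewrite !tnth_mktuple !mul1r -addrA -mulrDl.
by rewrite [t + s]addrC st mul0r addr0.
Qed.

Lemma shear0 z : shear 0 z = z.
Proof.
rewrite [RHS]surjective_pairing; congr pair.
by apply: eq_from_tnth => i; rewrite !tnth_mktuple mul1r mul0r addr0.
Qed.

Lemma dot_shear s z y : dot (shear s z).2 y = dot z.2 y + s * dot z.1 y.
Proof.
rewrite /dot mulr_sumr -big_split/=; apply: eq_bigr => i _.
by rewrite shearE2 mulrDl mulrA.
Qed.

Lemma measurable_shear s : measurable_fun setT (shear s).
Proof.
apply: measurable_fun_pair; first exact: measurable_fst.
apply/measurable_fun_tnthP => i.
rewrite (_ : _ \o _ = fun z => tnth z.2 i + s * tnth z.1 i); last first.
  by apply/funext => z /=; rewrite !tnth_mktuple mul1r.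
apply: measurable_funD.
  by apply: (measurableT_comp (measurable_tnth i)); exact: measurable_snd.
apply: measurable_funM => //.
by apply: (measurableT_comp (measurable_tnth i)); exact: measurable_fst.
Qed.

Lemma shear_preserving s : measure_preserving lam (shear s).
Proof.
apply: (@skew_product_preserving _ _ _ _ _ mu mu id (fun x => affine_tuple 1 (scale s x))).
- by split.
- by move=> x; apply: leb_affine; left.
- exact: measurable_shear.
Qed.

Variables (B : set R2d) (rho : R).
Hypothesis mB : measurable B.

(** The integrand of [loc_integral] pulled back along the shear: the operators of the ball and of
    both its shears become integrals over the same set [B] and can be combined pointwise. *)
Definition coefficient s f y z : R[i] := stft f (shear s z) * atom (shear s z) y.

Lemma cmeas_coefficient s f y : L2 mu f -> cmeas (coefficient s f y).
Proof.
move=> Lf; apply: cmeasM; last by apply: cmeas_atom => //; exact: measurable_shear.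
have [m1 m2] := cmeas_stft (L2_cmeas Lf).
by split; [exact: (measurableT_comp m1 (measurable_shear s))
  |exact: (measurableT_comp m2 (measurable_shear s))].
Qed.

Lemma loc_integral_shear s f y : L2 mu f ->
  loc_integral (shear s @^-1` B) f y =
  cintegral lam (fun z => (\1_B z)%:C%C * coefficient (- s) f y z).
Proof.
move=> Lf.
have mw : cmeas (fun z => (\1_B z)%:C%C * coefficient (- s) f y z).
  by apply: cmeasM; [exact: cmeas_real|exact: cmeas_coefficient].
(* The preimage of [B] under [shear s] is its image under [shear (- s)], hence the parameter [- s]
   in the coefficient. *)
rewrite -(cintegral_preserving (shear_preserving s) mw).
apply: eq_cintegral => z; rewrite /coefficient shear_cancel ?addNr// mulrA.
by congr (_%:C%C * _ * _).
Qed.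

(** As a function of [y'], the vector representing the value at [y] of the rank-one operator of the
    sheared atom: its inner product with [f] is [coefficient s f y z]. This is what lets Bessel's
    inequality act for each fixed [y] and [z]. *)
Definition kern s z y y' : R[i] := conjc (atom (shear s z) y) * atom (shear s z) y'.

Lemma coefficientE s f y z : L2 mu f -> coefficient s f y z = inner mu f (kern s z y).
Proof.
move=> Lf; rewrite innerZr//; last exact: L2_atom.
by rewrite conjcK mulrC /coefficient stftE.
Qed.

Lemma L2_kern s z y : L2 mu (kern s z y).
Proof. by apply: L2Z; exact: L2_atom. Qed.

Definition chalf : R[i] := (2^-1)%:C%C.

Definition defect_kern s z y y' : R[i] :=
  chalf * kern s z y y' + chalf * kern (- s) z y y' + (-1) * kern 0 z y y'.

Lemma L2_defect_kern s z y : L2 mu (defect_kern s z y).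
Proof.
apply: L2D; last by apply: L2Z; exact: L2_kern.
by apply: L2D; apply: L2Z; exact: L2_kern.
Qed.

Definition defect s f y z : R[i] :=
  chalf * coefficient s f y z + chalf * coefficient (- s) f y z + (-1) * coefficient 0 f y z.

Lemma defectE s f y z : L2 mu f -> defect s f y z = inner mu f (defect_kern s z y).
Proof.
move=> Lf; rewrite /defect !coefficientE//.
have Lk t c : L2 mu (fun y' => c * kern t z y y') by apply: L2Z; exact: L2_kern.
rewrite innerDr//; last exact: L2D.
have Lk0 t : L2 mu (kern t z y) by exact: L2_kern.
rewrite innerDr// !innerZr//; try exact: L2_atom.
rewrite (_ : conjc chalf = chalf); last by apply: complex_eq; rewrite !reimE//= oppr0.
have -> : conjc (-1) = -1 :> R[i] by apply: complex_eq; rewrite !reimE/= ?oppr0.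
by [].
Qed.

(** The shear keeps the position [z.1], so both windows stay as they are and [s] survives in one
    phase factor only. *)
Lemma kern_phase s z y y' : kern s z y y' =
  (window (subt y z.1) * window (subt y' z.1))%:C%C *
  (expi (2 * pi * (dot z.2 y' - dot z.2 y)) * expi (s * (2 * pi * (dot z.1 y' - dot z.1 y)))).
Proof.
rewrite /kern /atom conj_mul conj_expi !dot_shear -[(shear s z).1]/(z.1).
rewrite (_ : conjc (gaussian _) = (window (subt y z.1))%:C%C); last first.
  by apply: complex_eq; rewrite !reimE//= oppr0.
rewrite (_ : gaussian (subt y' z.1) = (window (subt y' z.1))%:C%C)//.
rewrite mulrACA -!expiD. congr (_ * expi _); last by ring.
by rewrite -!rmorphM.
Qed.

Lemma sqn_defect_kern s z y y' : sqn (defect_kern s z y y') =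
  (window (subt y z.1) * window (subt y' z.1)) ^+ 2 *
  (1 - cos (s * (2 * pi * (dot z.1 y' - dot z.1 y)))) ^+ 2.
Proof.
rewrite /defect_kern !kern_phase.
set W := _ * window _; set a := expi (2 * pi * (dot z.2 y' - _)); set t := 2 * pi * _.
rewrite (_ : _ + _ = W%:C%C * a * (cos (s * t) - 1)%:C%C); last first.
  rewrite [- s * t]mulNr [0 * t]mul0r mulN1r.
  have -> : expi 0 = 1 :> R[i] by rewrite /expi cos0 sin0.
  have -> : (cos (s * t) - 1)%:C%C = chalf * expi (s * t) + chalf * expi (- (s * t)) - 1.
    by apply: complex_eq; rewrite !reimE/= ?cosN ?sinN; field.
  ring.
rewrite !sqnM !sqn_real sqn_expi mulr1; ring.
Qed.

(** With t = |y|^2: 1 + t <= e^t, and (1 + t)^2 <= 4 (1 + t/2)^2 <= 4 e^t. This absorbs the growth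
    of the phase difference in [y] and [y']. *)
Lemma decay_poly y : decay y * (1 + dot y y) <= 1 /\
  (decay y * (1 + dot y y)) ^+ 2 <= 4 * decay y.
Proof.
have t0 := dot_ge0 y; rewrite /decay; set t := dot y y in t0 *.
have e1 : 1 + t <= expR t := expR_ge1Dx t.
have e2 : 1 + t / 2 <= expR (t / 2) := expR_ge1Dx _.
have N : expR (- t) * expR t = 1 by rewrite -expRD addNr expR0.
have P : 0 < expR (- t) := expR_gt0 _.
have H : expR t = expR (t / 2) ^+ 2 by rewrite -expRM_natl mulrC divfK.
split.
  apply: (@le_trans _ _ (expR (- t) * expR t)); last by rewrite N.
  by rewrite ler_wpM2l // ltW.
have h3 : (1 + t) ^+ 2 <= 4 * expR t.
  rewrite H; have : (1 + t / 2) ^+ 2 <= expR (t / 2) ^+ 2.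
    by rewrite lerXn2r ?nnegrE ?expR_ge0 //; lra.
  by move=> ?; nra.
rewrite exprMn expr2 -mulrA.
apply: (@le_trans _ _ (expR (- t) * (expR (- t) * (4 * expR t)))).
  by rewrite !ler_wpM2l// ltW.
by rewrite [expR (- t) * (4 * _)]mulrCA N mulr1 mulrC.
Qed.

(** For a phase difference t, t^2/2 = 2 pi^2 s^2 (x.(y' - y))^2, and the last square is at most rho
    times 2 (1 + |y|^2)(1 + |y'|^2): this gives 4 pi^2 rho. The two windows give the square of
    [window_cst]. The final 4, squared, is the product of the factors 4 from [decay_poly] for [y]
    and for [y']. *)
Definition defect_cst : R := (4 * (pi ^+ 2 * rho * window_cst d rho ^+ 2) * 4) ^+ 2.

Lemma sqn_defect_kern_le s z y y' : dot z.1 z.1 <= rho ->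
  sqn (defect_kern s z y y') <= s ^+ 4 * defect_cst * decay y * decay y'.
Proof.
move=> zr; rewrite sqn_defect_kern -exprMn.
set t := s * _.
have [c0 c1] : 0 <= 1 - cos t /\ 1 - cos t <= t ^+ 2 / 2 by apply/andP; exact: cos_lower.
(* Cauchy-Schwarz, then |y' - y|^2 <= 2|y|^2 + 2|y'|^2, enlarged to a product in order to separate
   [y] from [y']. *)
have dd : (dot z.1 y' - dot z.1 y) ^+ 2 <= rho * (2 * ((1 + dot y y) * (1 + dot y' y'))).
  have -> : dot z.1 y' - dot z.1 y = dot z.1 (subt y' y).
    rewrite /dot -sumrB; apply: eq_bigr => i _; rewrite tnth_mktuple; ring.
  apply: le_trans (dot_cauchy_schwarz _ _) _.
  apply: ler_pM => //; try exact: dot_ge0.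
  have h : 0 <= \sum_(i < d) (tnth y' i + tnth y i) ^+ 2 by apply: sumr_ge0 => i _; exact: sqr_ge0.
  have e : \sum_(i < d) (tnth y' i + tnth y i) ^+ 2 = dot y' y' + 2 * dot y' y + dot y y.
    by rewrite /dot mulr_sumr -!big_split/=; apply: eq_bigr => i _; ring.
  have := dot_ge0 y; have := dot_ge0 y'; rewrite dot_subt; rewrite e in h.
  by move=> ? ?; nra.
have W0 := window_ge0 (subt y z.1); have W0' := window_ge0 (subt y' z.1).
have W1 := window_le y zr; have W1' := window_le y' zr.
have [p1 p2] := decay_poly y; have [p1' p2'] := decay_poly y'.
have C0 := @window_cst_ge0 R d rho; have D0 := decay_ge0 y; have D0' := decay_ge0 y'.
set C := window_cst d rho in W1 W1' C0 *.
have Q0 : 0 <= 1 + dot y y by rewrite addr_ge0// dot_ge0.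
have Q0' : 0 <= 1 + dot y' y' by rewrite addr_ge0// dot_ge0.
have main : window (subt y z.1) * window (subt y' z.1) * (1 - cos t) <=
   s ^+ 2 * (4 * (pi ^+ 2 * rho * C ^+ 2)) *
   ((decay y * (1 + dot y y)) * (decay y' * (1 + dot y' y'))).
  apply: (@le_trans _ _ ((C * decay y) * (C * decay y') * (t ^+ 2 / 2))).
    by apply: ler_pM => //; [exact: mulr_ge0|apply: ler_pM].
  have -> : t ^+ 2 / 2 = s ^+ 2 * (2 * pi ^+ 2) * (dot z.1 y' - dot z.1 y) ^+ 2.
    by rewrite /t; field.
  apply: (@le_trans _ _ ((C * decay y) * (C * decay y') * (s ^+ 2 * (2 * pi ^+ 2) *
     (rho * (2 * ((1 + dot y y) * (1 + dot y' y'))))))).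
    rewrite ler_wpM2l//; first by apply: mulr_ge0; exact: mulr_ge0.
    by rewrite ler_wpM2l// mulr_ge0 ?sqr_ge0// mulr_ge0 ?sqr_ge0.
  by rewrite le_eqVlt; apply/orP; left; apply/eqP; ring.
have -> : s ^+ 4 * defect_cst * decay y * decay y' =
  (s ^+ 2 * (4 * (pi ^+ 2 * rho * C ^+ 2))) ^+ 2 * ((4 * decay y) * (4 * decay y')).
  by rewrite /defect_cst -/C; ring.
apply: (@le_trans _ _ ((s ^+ 2 * (4 * (pi ^+ 2 * rho * C ^+ 2)) *
   ((decay y * (1 + dot y y)) * (decay y' * (1 + dot y' y')))) ^+ 2)).
  have L0 : 0 <= window (subt y z.1) * window (subt y' z.1) * (1 - cos t).
    by apply: mulr_ge0 => //; exact: mulr_ge0.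
  by rewrite lerXn2r ?nnegrE//; exact: le_trans main.
rewrite exprMn ler_wpM2l ?sqr_ge0// exprMn ler_pM ?sqr_ge0//.
Qed.

Definition decay_mass : R := \int[mu]_y decay y.

Lemma nrm_defect_kern_le s z y : dot z.1 z.1 <= rho ->
  nrm mu (defect_kern s z y) <= s ^+ 4 * defect_cst * decay_mass * decay y.
Proof.
move=> zr.
have -> : s ^+ 4 * defect_cst * decay_mass * decay y =
   s ^+ 4 * defect_cst * decay y * decay_mass by ring.
rewrite -RintegralZl//; last exact: decay_integrable.
apply: Rintegral_mono.
- exact: L2_int (L2_defect_kern _ _ _).
- by apply: integrableRZ; exact: decay_integrable.
- by move=> y'; exact: sqn_defect_kern_le.
Qed.

Lemma nrm_kern0_le z y : dot z.1 z.1 <= rho ->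
  nrm mu (kern 0 z y) <= window_cst d rho ^+ 4 * decay_mass * decay y.
Proof.
move=> zr.
have -> : window_cst d rho ^+ 4 * decay_mass * decay y =
   window_cst d rho ^+ 4 * decay y * decay_mass by ring.
rewrite -RintegralZl//; last exact: decay_integrable.
apply: Rintegral_mono.
- exact: L2_int (L2_kern _ _ _).
- by apply: integrableRZ; exact: decay_integrable.
- move=> y'; rewrite /kern sqnM sqn_conj shear0.
  apply: le_trans (ler_pM (sqn_ge0 _) (sqn_ge0 _) (sqn_atom_le y zr) (sqn_atom_le y' zr)) _.
  by rewrite le_eqVlt; apply/orP; left; apply/eqP; ring.
Qed.

End Shear.

Arguments decay_mass R d : clear implicits.
Arguments defect_cst {R} d rho.

(** * The energy of opposite shears *)

Section SumSqn.
Context d (T : measurableType d) (R : realType) (mu : {measure set T -> \bar R}).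

(** Cauchy-Schwarz costs one factor [v], integrating the constant [K] over [A] the other. The bound
    does not grow with the list, so a Bessel bound at each point of [A] passes to the integrals. *)
Lemma sum_sqn_cintegral_le (I : eqType) (s : seq I) (A : set T) (w : I -> T -> R[i])
    (c : I -> R) (v K : R) : measurable A -> mu A = v%:E -> 0 < v ->
  (forall i, i \in s -> cmeas (w i) /\
     forall x, A x -> `|re (w i x)| <= c i /\ `|im (w i x)| <= c i) ->
  (forall x, A x -> \sum_(i <- s) sqn (w i x) <= K) ->
  \sum_(i <- s) sqn (cintegral mu (fun x => (\1_A x)%:C%C * w i x)) <= v ^+ 2 * K.
Proof.
move=> mA Av v0 hw hK.
have Aoo : (mu A < +oo)%E by rewrite Av ltry.
have B i : i \in s -> mu.-integrable setT (EFin \o (fun x => \1_A x * sqn (w i x))) /\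
  sqn (cintegral mu (fun x => (\1_A x)%:C%C * w i x)) <= v * \int[mu]_x (\1_A x * sqn (w i x)).
  by move=> /hw[mw bw]; exact: sqn_cintegral_le bw.
apply: (@le_trans _ _ (\sum_(i <- s) v * \int[mu]_x (\1_A x * sqn (w i x)))).
  by rewrite big_seq [leRHS]big_seq; apply: ler_sum => i /B[].
rewrite -mulr_sumr expr2 -mulrA ler_wpM2l ?(ltW v0)//.
have [si <-] := @Rintegral_sum _ _ _ mu I s (fun i x => \1_A x * sqn (w i x)) (fun i si => (B i si).1).
have -> : v * K = \int[mu]_x (K * \1_A x).
  rewrite RintegralZl//; last exact: integrable_indic_fin.
  by rewrite /Rintegral integral_indic// setIT Av mulrC.
apply: Rintegral_mono => //.
- by apply: integrableRZ; exact: integrable_indic_fin.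
- move=> x; rewrite -mulr_sumr indicE; have [/set_mem/hK|_] := boolP (x \in A).
    by rewrite (_ : true%:R = 1 :> R)// mul1r mulr1.
  by rewrite mul0r mulr0.
Qed.

End SumSqn.

(** With D = (a + b)/2 - c, one has |a|^2 + |b|^2 >= 2|c + D|^2, and the cross term of c and D is
    split with weights [s^2] and [s^-2]. As D will be of order [s^2], both error terms are then of
    order [s^2]. *)
Lemma sqn_parallelogram {R : realType} (a b c : R[i]) (s : R) : s != 0 ->
  2 * sqn c <= sqn a + sqn b +
    (2 * s ^+ 2 * sqn c + 2 * s ^- 2 * sqn (chalf * a + chalf * b + (-1) * c)).
Proof.
move=> s0; set D := chalf * a + chalf * b + (-1) * c.
have bE : b = 2%:C%C * (c + D) - a.
  by rewrite /D; apply: complex_eq; rewrite !reimE/=; field.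
clearbody D; rewrite {}bE; case: a D c => [a1 a2] [D1 D2] [c1 c2]; rewrite /sqn !reimE/=.
rewrite !(mul0r, subr0, addr0).
have sp : 0 < s ^+ 2 by rewrite exprn_even_gt0.
set u := s ^+ 2 in sp *; set w := u^-1.
have uw : u * w = 1 by rewrite divff// gt_eqF.
have w0 : 0 < w by rewrite invr_gt0.
(* The weighted square behind the splitting: since u w = 1, the expression is w (u x + y)^2. *)
have h (x y : R) : 0 <= u * x ^+ 2 + 2 * x * y + w * y ^+ 2.
  have -> : u * x ^+ 2 + 2 * x * y + w * y ^+ 2 = w * (u * x + y) ^+ 2.
    have -> : w * (u * x + y) ^+ 2 = (u * w) * u * x ^+ 2 + (u * w) * 2 * x * y + w * y ^+ 2 by ring.
    by rewrite uw; ring.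
  by rewrite mulr_ge0 ?sqr_ge0// ltW.
have h1 := h c1 D1; have h2 := h c2 D2.
have s1 := sqr_ge0 (a1 - (c1 + D1)); have s2 := sqr_ge0 (a2 - (c2 + D2)).
have q1 := sqr_ge0 D1; have q2 := sqr_ge0 D2.
by nra.
Qed.

Section Energy.
Context {R : realType} {d : nat}.
Local Notation Rd := (d.-tuple R).
Local Notation R2d := (d.-tuple R * d.-tuple R)%type.
Local Notation mu := (leb R d).
Local Notation lam := (@leb2 R d).
Implicit Types (y : Rd) (z : R2d) (f g e : Rd -> R[i]) (s : R).

Variables (B : set R2d) (rho v : R).
Hypothesis mB : measurable B.
Hypothesis Bv : lam B = v%:E.
Hypothesis v0 : 0 < v.
Hypothesis B_bnd : forall z, B z -> dot z.1 z.1 <= rho.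

Lemma coefficient_le s f y z : L2 mu f -> B z ->
  `|re (coefficient s f y z)| <= loc_cst rho f * decay y /\
  `|im (coefficient s f y z)| <= loc_cst rho f * decay y.
Proof. by move=> Lf /B_bnd zr; exact: stft_atom_le. Qed.

Lemma defect_le s f y z : L2 mu f -> B z ->
  `|re (defect s f y z)| <= 2 * (loc_cst rho f * decay y) /\
  `|im (defect s f y z)| <= 2 * (loc_cst rho f * decay y).
Proof.
move=> Lf Bz.
have [a1 a2] := coefficient_le s y Lf Bz; have [b1 b2] := coefficient_le (- s) y Lf Bz.
have [c1 c2] := coefficient_le 0 y Lf Bz.
move: a1 a2 b1 b2 c1 c2; rewrite /defect.
move: (coefficient s f y z) (coefficient (- s) f y z) (coefficient 0 f y z) => [a a'] [b b'] [c c'].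
rewrite !reimE/= !ler_norml => /andP[? ?] /andP[? ?] /andP[? ?] /andP[? ?] /andP[? ?] /andP[? ?].
by split; apply/andP; split; lra.
Qed.

Lemma cmeas_defect s f y : L2 mu f -> cmeas (defect s f y).
Proof.
move=> Lf.
have m t (c : R[i]) : cmeas (fun z => c * coefficient t f y z).
  by apply: cmeasM; [exact: (@cmeas_cst _ _ R c)|exact: cmeas_coefficient].
by apply: cmeasD => //; exact: cmeasD.
Qed.

Lemma integral_coefficient0 f y : L2 mu f ->
  loc_integral B f y = cintegral lam (fun z => (\1_B z)%:C%C * coefficient 0 f y z).
Proof. by move=> Lf; apply: eq_cintegral => z; rewrite /coefficient shear0 mulrA. Qed.

Let Boo : (lam B < +oo)%E. Proof. by rewrite Bv ltry. Qed.

Lemma integral_defect s f y : L2 mu f ->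
  cintegral lam (fun z => (\1_B z)%:C%C * defect s f y z) =
  chalf * loc_integral (shear (- s) @^-1` B) f y + chalf * loc_integral (shear s @^-1` B) f y
  + (-1) * loc_integral B f y.
Proof.
move=> Lf; rewrite integral_coefficient0// !loc_integral_shear// opprK.
have ic t : cint lam (fun z => (\1_B z)%:C%C * coefficient t f y z).
  apply: (cint_indic_bounded mB Boo) => [|z Bz]; first exact: cmeas_coefficient.
  exact: coefficient_le Lf Bz.
have icc c t : cint lam (fun z => c * ((\1_B z)%:C%C * coefficient t f y z)) by exact: cintZ.
rewrite -!cintegralZ// -!cintegralD//; last exact: cintD.
by apply: eq_cintegral => z; rewrite /defect; ring.
Qed.

Section Orthonormal.
Variables (E : set (Rd -> R[i])) (F : seq (Rd -> R[i])).
Hypothesis oE : orthonormal_family mu E.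
Hypothesis uF : uniq F.
Hypothesis FE : forall e, e \in F -> E e.

Let FL2 e : e \in F -> L2 mu e.
Proof. by move=> /FE; have [+ _ _] := oE; exact. Qed.

Lemma sum_inner_le (k : Rd -> R[i]) : L2 mu k ->
  \sum_(e <- F) sqn (inner mu e k) <= nrm mu k.
Proof.
move=> Lk; apply: le_trans (bessel oE uF FE Lk).
rewrite big_seq [leRHS]big_seq; apply: ler_sum => e eF.
by rewrite inner_conj ?sqn_conj//; exact: FL2.
Qed.

Definition energy_cst : R := v ^+ 2 * (window_cst d rho ^+ 4 * decay_mass R d).
Definition deficit_cst : R := v ^+ 2 * (defect_cst d rho * decay_mass R d).

(** For fixed [y] the values at [y] are integrals over [B] of inner products of the [e] with one
    vector [kern 0 z y]. Bessel bounds their squares at each [z], independently of [F]. *)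
Lemma sum_loc_integral_le y :
  \sum_(e <- F) sqn (loc_integral B e y) <= energy_cst * decay y.
Proof.
have -> : energy_cst * decay y = v ^+ 2 * (window_cst d rho ^+ 4 * decay_mass R d * decay y).
  by rewrite /energy_cst; ring.
rewrite big_seq; under eq_bigr => e eF do rewrite (integral_coefficient0 y (FL2 eF)).
rewrite -big_seq.
apply: (sum_sqn_cintegral_le (c := fun e => loc_cst rho e * decay y)) => //.
- move=> e /FL2 Le; split; first exact: cmeas_coefficient.
  by move=> z; exact: coefficient_le.
- move=> z Bz.
  rewrite big_seq; under eq_bigr => e eF do rewrite (coefficientE 0 y z (FL2 eF)).
  rewrite -big_seq; apply: le_trans (sum_inner_le (L2_kern 0 z y)) _.
  by apply: nrm_kern0_le; exact: B_bnd.
Qed.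

Lemma sum_defect_le s y :
  \sum_(e <- F) sqn (chalf * loc_integral (shear (- s) @^-1` B) e y +
     chalf * loc_integral (shear s @^-1` B) e y + (-1) * loc_integral B e y)
  <= s ^+ 4 * deficit_cst * decay y.
Proof.
have -> : s ^+ 4 * deficit_cst * decay y =
   v ^+ 2 * (s ^+ 4 * defect_cst d rho * decay_mass R d * decay y).
  by rewrite /deficit_cst; ring.
rewrite big_seq; under eq_bigr => e eF do rewrite -(integral_defect s y (FL2 eF)).
rewrite -big_seq.
apply: (sum_sqn_cintegral_le (c := fun e => 2 * (loc_cst rho e * decay y))) => //.
- move=> e /FL2 Le; split; first exact: cmeas_defect.
  by move=> z; exact: defect_le.
- move=> z Bz.
  rewrite big_seq; under eq_bigr => e eF do rewrite (defectE s y z (FL2 eF)).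
  rewrite -big_seq; apply: le_trans (sum_inner_le (L2_defect_kern s z y)) _.
  by apply: nrm_defect_kern_le; exact: B_bnd.
Qed.

Let mS s : measurable (shear s @^-1` B).
Proof. by rewrite -[X in measurable X]setTI; exact: measurable_shear. Qed.

Let Soo s : (lam (shear s @^-1` B) < +oo)%E.
Proof. by have [_ ->] := shear_preserving (R := R) (d := d) s. Qed.

Let S_bnd s z : (shear s @^-1` B) z -> dot z.1 z.1 <= rho.
Proof. exact: B_bnd. Qed.

(** The bound is uniform in [F]; it makes the Hilbert-Schmidt norm of the ball's operator finite. *)
Lemma sum_nrm_le : \sum_(e <- F) nrm mu (loc_integral B e) <= energy_cst * decay_mass R d.
Proof.
have iB e : e \in F -> mu.-integrable setT (EFin \o (fun y => sqn (loc_integral B e y))).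
  by move=> /FL2 Le; apply: L2_int; exact: (L2_loc_integral mB Boo B_bnd).
have [iS <-] := Rintegral_sum iB.
rewrite -RintegralZl//; last exact: decay_integrable.
apply: Rintegral_mono => //; first by apply: integrableRZ; exact: decay_integrable.
exact: sum_loc_integral_le.
Qed.

(** [sqn_parallelogram] summed over [F] and integrated in [y]. The defect contributes s^-2 times
    s^4, the weight on [L_B] itself s^2. *)
Lemma energy_almost_convex s : s != 0 ->
  2 * \sum_(e <- F) nrm mu (loc_integral B e) <=
  \sum_(e <- F) (nrm mu (loc_integral (shear (- s) @^-1` B) e) +
                 nrm mu (loc_integral (shear s @^-1` B) e))
  + s ^+ 2 * (2 * (energy_cst + deficit_cst) * decay_mass R d).
Proof.
move=> s0.
have iB e : e \in F -> mu.-integrable setT (EFin \o (fun y => sqn (loc_integral B e y))).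
  by move=> /FL2 Le; apply: L2_int; exact: (L2_loc_integral mB Boo B_bnd).
have iS t e : e \in F ->
    mu.-integrable setT (EFin \o (fun y => sqn (loc_integral (shear t @^-1` B) e y))).
  by move=> /FL2 Le; apply: L2_int; exact: (L2_loc_integral (mS t) (Soo t) (@S_bnd t)).
have iSS e : e \in F -> mu.-integrable setT (EFin \o
    (fun y => sqn (loc_integral (shear (- s) @^-1` B) e y) + sqn (loc_integral (shear s @^-1` B) e y))).
  by move=> eF; apply: integrableRD; exact: iS.
have [jB <-] := Rintegral_sum iB.
rewrite big_seq; under [in leRHS]eq_bigr => e eF do rewrite -(RintegralD measurableT (iS _ _ eF) (iS _ _ eF)).
rewrite -big_seq; have [jS <-] := Rintegral_sum iSS.
rewrite mulrA -!RintegralZl//; last exact: decay_integrable.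
rewrite -RintegralD//; last by apply: integrableRZ; exact: decay_integrable.
apply: Rintegral_mono.
- exact: integrableRZ.
- by apply: integrableRD => //; apply: integrableRZ; exact: decay_integrable.
move=> y.
have h1 := sum_loc_integral_le y; have h2 := sum_defect_le s y.
apply: (@le_trans _ _ (\sum_(e <- F) (sqn (loc_integral (shear (- s) @^-1` B) e y) +
    sqn (loc_integral (shear s @^-1` B) e y) + (2 * s ^+ 2 * sqn (loc_integral B e y) +
   2 * s ^- 2 * sqn (chalf * loc_integral (shear (- s) @^-1` B) e y +
     chalf * loc_integral (shear s @^-1` B) e y + (-1) * loc_integral B e y))))).
  by rewrite mulr_sumr; apply: ler_sum => e _; exact: sqn_parallelogram.
rewrite big_split/= lerD2l big_split/= -!mulr_sumr.
have -> : s ^+ 2 * (2 * (energy_cst + deficit_cst)) * decay y =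
  2 * s ^+ 2 * (energy_cst * decay y) + 2 * s ^- 2 * (s ^+ 4 * deficit_cst * decay y).
  by field.
by apply: lerD; rewrite ler_wpM2l// mulr_ge0// ?invr_ge0 sqr_ge0.
Qed.

End Orthonormal.

End Energy.

Arguments energy_cst {R} d rho v.
Arguments deficit_cst {R} d rho v.

(** * Hilbert-Schmidt norms *)

Section HilbertSchmidt.
Context {R : realType} {d : nat}.
Local Notation Rd := (d.-tuple R).
Local Notation R2d := (d.-tuple R * d.-tuple R)%type.
Local Notation mu := (leb R d).
Local Notation lam := (@leb2 R d).
Implicit Types (E A : set (Rd -> R[i])).

Section Bounded.
Variables (Omega : set R2d) (rho : R).
Hypothesis mO : measurable Omega.
Hypothesis Ooo : (lam Omega < +oo)%E.
Hypothesis O_bnd : forall z, Omega z -> dot z.1 z.1 <= rho.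

Lemma fsum_loc_op E A : E `<=` L2 mu -> finite_set A -> A `<=` E ->
  (\sum_(e \in A) L2norm2 mu (loc_op Omega e))%E =
  (\sum_(e <- fset_set A) nrm mu (loc_integral Omega e))%:E.
Proof.
move=> EL2 fA AE; rewrite fsbig_finite//= -sumEFin big_seq [RHS]big_seq.
apply: eq_bigr => e; rewrite in_fset_set// => /set_mem/AE/EL2 Le.
exact: (L2norm2_loc_op mO Ooo O_bnd).
Qed.

Lemma sum_le_hs_norm2 E A : orthonormal_basis mu E -> finite_set A -> A `<=` E ->
  ((\sum_(e <- fset_set A) nrm mu (loc_integral Omega e))%:E <=
    hs_norm2 mu (loc_op Omega))%E.
Proof.
move=> bE fA AE; have [EL2 _ _ _] := bE.
rewrite -(fsum_loc_op EL2 fA AE).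
apply: (@le_trans _ _ (\esum_(e in E) L2norm2 mu (loc_op Omega e))).
  by apply: ereal_sup_ubound; exists A.
by apply: ereal_sup_ubound; exists E.
Qed.

Lemma hs_norm2_le (K : R) :
  (forall E A, orthonormal_basis mu E -> finite_set A -> A `<=` E ->
    \sum_(e <- fset_set A) nrm mu (loc_integral Omega e) <= K) ->
  (hs_norm2 mu (loc_op Omega) <= K%:E)%E.
Proof.
move=> h; apply: ge_ereal_sup => _ [E bE <-].
apply: ge_ereal_sup => _ [A [fA AE] <-].
have [EL2 _ _ _] := bE.
by rewrite (fsum_loc_op EL2 fA AE) lee_fin; exact: h bE fA AE.
Qed.

(** The supremum over an empty set of bases would be [-oo]; the existence of a basis enters here,
    with the empty partial sum. *)
Lemma hs_norm2_ge0 : (0 <= hs_norm2 mu (loc_op Omega))%E.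
Proof.
have [E bE] := exists_orthonormal_basis mu.
have := sum_le_hs_norm2 bE (finite_set0 _) (@sub0set _ E).
by rewrite fset_set0 big_nil.
Qed.

End Bounded.

Variables (B : set R2d) (rho v : R).
Hypothesis mB : measurable B.
Hypothesis Bv : lam B = v%:E.
Hypothesis v0 : 0 < v.
Hypothesis B_bnd : forall z, B z -> dot z.1 z.1 <= rho.

(** Along any one basis the partial sums for [B] are controlled by those of the two shears, and
    these by the assumed upper bounds. Taking the supremum puts the norm for [B] on both sides,
    where it cancels. *)
Lemma hs_deficit_quadratic : exists C : R, forall s delta1 delta2 : R, s != 0 ->
  (hs_norm2 mu (loc_op (shear (- s) @^-1` B)) <= hs_norm2 mu (loc_op B) - delta1%:E)%E ->
  (hs_norm2 mu (loc_op (shear s @^-1` B)) <= hs_norm2 mu (loc_op B) - delta2%:E)%E ->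
  delta1 + delta2 <= C * s ^+ 2.
Proof.
have Boo : (lam B < +oo)%E by rewrite Bv ltry.
have mS s : measurable (shear s @^-1` B).
  by rewrite -[X in measurable X]setTI; exact: measurable_shear.
have Soo s : (lam (shear s @^-1` B) < +oo)%E.
  by have [_ ->] := shear_preserving (R := R) (d := d) s.
have S_bnd s z : (shear s @^-1` B) z -> dot z.1 z.1 <= rho by exact: B_bnd.
have inA A (e : Rd -> R[i]) : finite_set A -> e \in fset_set A -> A e.
  by move=> fA; rewrite in_fset_set// => /set_mem.
have uA A : uniq (fset_set A) by exact: fset_uniq.
(* The cancellation at the end takes place in [R], so the norm must first be shown finite. *)
have [H HE] : exists H : R, hs_norm2 mu (loc_op B) = H%:E.
  have h0 := hs_norm2_ge0 mB Boo B_bnd.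
  have h1 : (hs_norm2 mu (loc_op B) <= (energy_cst d rho v * decay_mass R d)%:E)%E.
    apply: (hs_norm2_le mB Boo B_bnd) => E A bE fA AE.
    apply: (sum_nrm_le mB Bv v0 B_bnd (orthonormal_basis_family bE) (uA A)).
    by move=> e /(inA _ _ fA); exact: AE.
  exists (fine (hs_norm2 mu (loc_op B))); rewrite fineK//.
  by rewrite ge0_fin_numE// (le_lt_trans h1)// ltry.
exists (2 * (energy_cst d rho v + deficit_cst d rho v) * decay_mass R d) => s d1 d2 s0.
rewrite HE -!EFinB => h1 h2.
set C := 2 * _ * _.
have aux (a b c t : R) : 2 * a <= b + c + t * C -> b <= H - d1 -> c <= H - d2 ->
  a <= H + (C * t - d1 - d2) / 2 by clear; clearbody C; lra.
have : (hs_norm2 mu (loc_op B) <= (H + (C * s ^+ 2 - d1 - d2) / 2)%:E)%E.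
  apply: (hs_norm2_le mB Boo B_bnd) => E A bE fA AE.
  have uE := orthonormal_basis_family bE.
  have AE' e : e \in fset_set A -> E e by move=> /(inA _ _ fA); exact: AE.
  have h3 : 2 * \sum_(e <- fset_set A) nrm mu (loc_integral B e) <=
      \sum_(e <- fset_set A) (nrm mu (loc_integral (shear (- s) @^-1` B) e) +
        nrm mu (loc_integral (shear s @^-1` B) e)) + s ^+ 2 * C.
    exact: (energy_almost_convex mB Bv v0 B_bnd uE (uA A) AE' s0).
  clearbody C; rewrite big_split in h3.
  have h4 := le_trans (sum_le_hs_norm2 (mS s) (Soo s) (@S_bnd s) bE fA AE) h2.
  have h5 := le_trans (sum_le_hs_norm2 (mS (- s)) (Soo (- s)) (@S_bnd (- s)) bE fA AE) h1.
  rewrite lee_fin in h4; rewrite lee_fin in h5.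
  exact: (aux _ _ _ _ h3 h5 h4).
rewrite HE lee_fin; clearbody C; move: (C * _) => t; clear h1 h2 HE aux; lra.
Qed.

End HilbertSchmidt.

(** * Balls in phase space *)

Section Balls.
Context {R : realType} {d : nat}.
Local Notation Rd := (d.-tuple R).
Local Notation R2d := (d.-tuple R * d.-tuple R)%type.
Local Notation lam := (@leb2 R d).
Implicit Types (x y : Rd) (z c : R2d) (r s : R).

Lemma measurable_ball2 c r : measurable (ball2 c r).
Proof.
rewrite (_ : ball2 c r = (fun z => dot (subt z.1 c.1) (subt z.1 c.1)
           + dot (subt z.2 c.2) (subt z.2 c.2)) @^-1` `]-oo, (r ^+ 2)[%classic); last first.
  by apply/seteqP; split => z; rewrite /= in_itv.
rewrite -[X in measurable X]setTI.
have m1 : measurable_fun setT (fun z : R2d => subt z.1 c.1).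
  by apply: measurable_subt; [exact: measurable_fst|exact: measurable_cst].
have m2 : measurable_fun setT (fun z : R2d => subt z.2 c.2).
  by apply: measurable_subt; [exact: measurable_snd|exact: measurable_cst].
have m : measurable_fun setT (fun z : R2d => dot (subt z.1 c.1) (subt z.1 c.1)
           + dot (subt z.2 c.2) (subt z.2 c.2)).
  by apply: measurable_funD; exact: measurable_dot.
exact: m.
Qed.

Lemma subt0 x : subt x [tuple 0 | _ < d] = x.
Proof. by apply: eq_from_tnth => i; rewrite !tnth_mktuple subr0. Qed.

Lemma ball2_originE r z : ball2 origin r z <-> dot z.1 z.1 + dot z.2 z.2 < r ^+ 2.
Proof. by rewrite /ball2 /= !subt0. Qed.

Lemma tnth_sqr_le x i : tnth x i ^+ 2 <= dot x x.
Proof.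
rewrite /dot (bigD1 i)//= -expr2 lerDl; apply: sumr_ge0 => j _.
by rewrite -expr2 sqr_ge0.
Qed.

Lemma ball2_sub_box r : 0 < r -> ball2 origin r `<=` @box R d (- r) r `*` @box R d (- r) r.
Proof.
move=> r0 z /ball2_originE h.
have b (x : Rd) : dot x x < r ^+ 2 -> box (- r) r x.
  move=> xr i; have := le_lt_trans (tnth_sqr_le x i) xr.
  by move=> ?; apply/andP; split; nra.
have := dot_ge0 z.1; have := dot_ge0 z.2 => h1 h2.
by split; apply: b; apply: le_lt_trans h; rewrite ?lerDl ?lerDr.
Qed.

Lemma leb2_boxes (a b : R) : a < b ->
  lam (@box R d a b `*` @box R d a b) = ((b - a) ^+ d * (b - a) ^+ d)%:E.
Proof.
move=> ab; have -> : lam (@box R d a b `*` @box R d a b) =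
    (leb R d (@box R d a b) * leb R d (@box R d a b))%E.
  by apply: product_measure1E; exact: measurable_box.
by rewrite [leb R d _]leb_box.
Qed.

Lemma measurable_boxes (a b : R) : measurable (@box R d a b `*` @box R d a b).
Proof. by apply: measurableX; exact: measurable_box. Qed.

Lemma ball2_fin r : 0 < r -> (lam (ball2 origin r) < +oo)%E.
Proof.
move=> r0; apply: (@le_lt_trans _ _ (lam (@box R d (- r) r `*` @box R d (- r) r))).
  apply: le_measure; rewrite ?inE; [exact: measurable_ball2|exact: measurable_boxes|].
  exact: ball2_sub_box.
by rewrite leb2_boxes ?ltry// gtrN.
Qed.

(** The condition a > 0 keeps the cube away from points with a vanishing coordinate, so that it
    bounds from below the volume of the ball and also its [position_moment]. *)
Lemma box_sub_ball2 r : (0 < d)%N -> 0 < r -> exists a b : R, [/\ 0 < a, a < b &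
  @box R d a b `*` @box R d a b `<=` ball2 origin r].
Proof.
move=> d0 r0; have dp : 0 < d%:R :> R by rewrite ltr0n.
have d1 : 1 <= d%:R :> R by rewrite ler1n.
(* Position and frequency each have squared norm at most d (r/(2d))^2 <= r^2/4, and twice that is
   below r^2. *)
exists (r / (4 * d%:R)), (r / (2 * d%:R)); split.
- by rewrite divr_gt0// mulr_gt0.
- by rewrite ltr_pM2l// ltf_pV2 ?posrE ?mulr_gt0// ltr_pM2r// ltr_nat.
move=> z [z1 z2]; apply/ball2_originE.
have h (x : Rd) : box (r / (4 * d%:R)) (r / (2 * d%:R)) x -> dot x x <= r ^+ 2 / 4.
  move=> bx; apply: (@le_trans _ _ (\sum_(i < d) (r / (2 * d%:R)) ^+ 2)).
    apply: ler_sum => i _; have /andP[h1 h2] := bx i.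
    rewrite -expr2 lerXn2r ?nnegrE//.
    - by apply: ltW; apply: lt_trans h1; rewrite divr_gt0// mulr_gt0.
    - by rewrite ltW// divr_gt0// mulr_gt0.
    - exact: ltW.
  rewrite sumr_const card_ord -[_ *+ d]mulr_natl.
  have -> : d%:R * (r / (2 * d%:R)) ^+ 2 = (r ^+ 2 / 4) * d%:R^-1.
    by field; rewrite gt_eqF.
  by rewrite ler_piMr ?invf_le1// divr_ge0// sqr_ge0.
have := h _ z1; have := h _ z2; have : 0 < r ^+ 2 by rewrite exprn_gt0.
by move=> ? ? ?; lra.
Qed.

Lemma ball2_gt0 r : (0 < d)%N -> 0 < r -> (0 < lam (ball2 origin r))%E.
Proof.
move=> d0 r0; have [a [b [a0 ab sub]]] := box_sub_ball2 d0 r0.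
apply: (@lt_le_trans _ _ (lam (@box R d a b `*` @box R d a b))).
  by rewrite leb2_boxes// lte_fin mulr_gt0// exprn_gt0// subr_gt0.
by apply: le_measure; rewrite ?inE; [exact: measurable_boxes|exact: measurable_ball2|].
Qed.

Definition affine2 s c z : R2d := (affine_tuple s c.1 z.1, affine_tuple s c.2 z.2).

Lemma affine2_preserving s c : s = 1 \/ s = -1 -> measure_preserving lam (affine2 s c).
Proof.
move=> s1; apply: (@skew_product_preserving _ _ _ _ _ (leb R d) (leb R d)
  (affine_tuple s c.1) (fun=> affine_tuple s c.2)).
- exact: leb_affine.
- by move=> _; exact: leb_affine.
- apply: measurable_fun_pair.
  + by apply: (measurableT_comp (measurable_affine_tuple s c.1)); exact: measurable_fst.
  + by apply: (measurableT_comp (measurable_affine_tuple s c.2)); exact: measurable_snd.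
Qed.

Lemma leb2_ball2 c r : lam (ball2 c r) = lam (ball2 origin r).
Proof.
pose c' := (scale (-1) c.1, scale (-1) c.2) : R2d.
have [_ ap] := affine2_preserving c' (or_introl (erefl 1)).
rewrite -[RHS]ap; last exact: measurable_ball2.
congr (lam _); apply/seteqP.
have E z : dot (subt z.1 c.1) (subt z.1 c.1) + dot (subt z.2 c.2) (subt z.2 c.2) =
   dot (affine2 1 c' z).1 (affine2 1 c' z).1 + dot (affine2 1 c' z).2 (affine2 1 c' z).2.
  by congr (_ + _); apply: eq_bigr => i _; rewrite !tnth_mktuple /=; ring.
have I z : ball2 origin r (affine2 1 c' z) <-> ball2 c r z by rewrite ball2_originE -E.
by split => z; [exact: (I z).2|exact: (I z).1].
Qed.

Definition opp2 : R2d -> R2d := affine2 (-1) origin.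

Lemma tnth_opp2 z i : tnth (opp2 z).1 i = - tnth z.1 i /\ tnth (opp2 z).2 i = - tnth z.2 i.
Proof. by rewrite !tnth_mktuple !mulN1r !addr0. Qed.

Lemma dot_opp2 z c : dot (opp2 z).1 c.1 + dot (opp2 z).2 c.2 = - (dot z.1 c.1 + dot z.2 c.2).
Proof.
rewrite opprD /dot -!sumrN; congr (_ + _); apply: eq_bigr => i _.
  by rewrite (tnth_opp2 z i).1 mulNr.
by rewrite (tnth_opp2 z i).2 mulNr.
Qed.

Lemma ball2_opp r z : ball2 origin r (opp2 z) <-> ball2 origin r z.
Proof.
rewrite !ball2_originE (_ : dot (opp2 z).1 _ + _ = dot z.1 z.1 + dot z.2 z.2)//.
by congr (_ + _); apply: eq_bigr => i _; rewrite ?(tnth_opp2 z i).1 ?(tnth_opp2 z i).2 mulrNN.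
Qed.

Lemma shear_opp2 s z : shear s (opp2 z) = opp2 (shear s z).
Proof.
rewrite /shear /opp2 /affine2 /=; congr pair; apply: eq_from_tnth => i.
by rewrite !tnth_mktuple; ring.
Qed.

(* For [z] in the half-space [<z, c> <= 0], the distance to [c] is at least the
   distance to the origin; by symmetry [O] has half of its excess over the
   centered ball in that half-space. *)
Lemma centered_ball_excess (O : set R2d) c r : measurable O ->
  (forall z, O (opp2 z) <-> O z) ->
  (lam (O `\` ball2 origin r) <= 2%:E * lam (O `\` ball2 c r))%E.
Proof.
move=> mO sO; pose D := O `\` ball2 origin r.
pose H := [set z : R2d | dot z.1 c.1 + dot z.2 c.2 <= 0].
have mH : measurable H.
  rewrite (_ : H = (fun z => dot z.1 c.1 + dot z.2 c.2) @^-1` `]-oo, 0]%classic); last first.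
    by apply/seteqP; split => z; rewrite /= in_itv.
  rewrite -[X in measurable X]setTI.
  have m : measurable_fun setT (fun z : R2d => dot z.1 c.1 + dot z.2 c.2).
    by apply: measurable_funD; apply: measurable_dot.
  exact: m.
have mD : measurable D by apply: measurableD => //; exact: measurable_ball2.
have mDH : measurable (D `&` H) by exact: measurableI.
have [mo op] := affine2_preserving (origin : R2d) (or_intror (erefl (-1))).
have mo' : measurable (opp2 @^-1` (D `&` H)).
  by rewrite -[X in measurable X]setTI; exact: mo.
have sub : D `<=` (D `&` H) `|` (opp2 @^-1` (D `&` H)).
  move=> z Dz; have [h|h] := leP (dot z.1 c.1 + dot z.2 c.2) 0; [by left|right].
  split; last by rewrite /H /= dot_opp2 oppr_le0 ltW.
  by case: Dz => Oz Bz; split; [exact/sO|move/ball2_opp].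
apply: (@le_trans _ _ (lam (D `&` H) + lam (opp2 @^-1` (D `&` H)))%E).
  apply: le_trans (measureU2 _ _ _) => //.
  by apply: le_measure; rewrite ?inE//; exact: measurableU.
rewrite (op _ mDH) -mule2n -mule_natl lee_pmul2l//.
apply: le_measure; rewrite ?inE//.
  by apply: measurableD => //; exact: measurable_ball2.
move=> z [[Oz nB] Hz]; split => // Bz; apply: nB; apply/ball2_originE.
move: Bz Hz; rewrite /ball2 /H /= !dot_subt => h1 h2.
by have := dot_ge0 c.1; have := dot_ge0 c.2; lra.
Qed.

Lemma ball2_nested r r' : 0 < r -> r <= r' -> ball2 origin r `<=` (ball2 origin r' : set R2d).
Proof.
move=> r0 rr z /ball2_originE h; apply/ball2_originE; apply: lt_le_trans h _.
by rewrite lerXn2r ?nnegrE// ltW// (lt_le_trans r0).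
Qed.

(** Replaces the uniqueness of the radius for a given volume: centered balls are nested, so two of
    equal volume differ by a null set. *)
Lemma same_volume_excess (O : set R2d) r r' : 0 < r -> 0 < r' -> measurable O ->
  lam (ball2 origin r') = lam (ball2 origin r) ->
  (lam (O `\` ball2 origin r) <= lam (O `\` ball2 origin r'))%E.
Proof.
move=> r0 r0' mO rr'.
have mD r1 : measurable (O `\` (ball2 origin r1 : set R2d)).
  by apply: measurableD => //; exact: measurable_ball2.
have [le_r|/ltW le_r] := leP r' r.
  apply: le_measure; rewrite ?inE//.
  by apply: setDS; exact: ball2_nested.
have mBB : measurable ((ball2 origin r' : set R2d) `\` ball2 origin r).
  by apply: measurableD; exact: measurable_ball2.
have BB0 : lam (ball2 origin r' `\` ball2 origin r) = 0%E.
  rewrite measureD ?ball2_fin//; [|exact: measurable_ball2..].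
  rewrite setIidr; last exact: ball2_nested.
  transitivity (lam (ball2 origin r) - lam (ball2 origin r))%E; first by congr (_ - _)%E.
  by apply: subee; rewrite ge0_fin_numE// ball2_fin.
rewrite -[leRHS]adde0 -BB0; apply: le_trans (measureU2 _ _ _) => //.
apply: le_measure; rewrite ?inE//; first exact: measurableU.
move=> z [Oz nB]; have [Bz|nBz] := pselect (ball2 origin r' z); [by right|by left].
Qed.

End Balls.

(** * Asymmetry of a sheared ball *)

Section Asymmetry.
Context {R : realType} {d : nat}.
Local Notation Rd := (d.-tuple R).
Local Notation R2d := (d.-tuple R * d.-tuple R)%type.
Local Notation lam := (@leb2 R d).
Implicit Types (x y : Rd) (z c : R2d).

Lemma dot_norm_le x y : `|dot x y| <= (dot x x + dot y y) / 2.
Proof.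
have p (e : R) : e ^+ 2 = 1 -> 0 <= dot x x + 2 * e * dot x y + dot y y.
  move=> e1; have -> : dot x x + 2 * e * dot x y + dot y y =
      \sum_(i < d) (tnth x i + e * tnth y i) ^+ 2.
    rewrite /dot mulr_sumr -!big_split/=; apply: eq_bigr => i _.
    have -> : tnth y i * tnth y i = e ^+ 2 * (tnth y i * tnth y i) by rewrite e1 mul1r.
    ring.
  by apply: sumr_ge0 => i _; exact: sqr_ge0.
have := p 1 (expr1n _ _); have : (-1) ^+ 2 = 1 :> R by ring.
by move=> /p; rewrite ler_norml => h1 h2; apply/andP; split; lra.
Qed.

Variables (r : R).
Hypothesis d0 : (0 < d)%N.
Hypothesis r0 : 0 < r.
Local Notation B := (ball2 origin r : set R2d).

Let mB : measurable B. Proof. exact: measurable_ball2. Qed.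
Let Boo : (lam B < +oo)%E. Proof. exact: ball2_fin. Qed.

Definition position_moment : R := \int[lam]_z (\1_B z * dot z.1 z.1).

Lemma ball2_fst_le z : B z -> dot z.1 z.1 <= r ^+ 2.
Proof.
by move/ball2_originE; have := dot_ge0 z.2; move=> ? ?; lra.
Qed.

Let mdot11 : measurable_fun setT (fun z : R2d => dot z.1 z.1).
Proof. by apply: measurable_dot. Qed.

Let mdot12 : measurable_fun setT (fun z : R2d => dot z.1 z.2).
Proof. by apply: measurable_dot. Qed.

Let moment_integrable : lam.-integrable setT (EFin \o (fun z => \1_B z * dot z.1 z.1)).
Proof.
apply: (integrable_indic_bounded (c := r ^+ 2)) => // z /ball2_fst_le.
by rewrite ger0_norm// dot_ge0.
Qed.

(** On the cube inside the ball every coordinate exceeds [a], so |x|^2 >= a^2 there; a single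
    coordinate is enough, and [d0] provides one. *)
Lemma position_moment_gt0 : 0 < position_moment.
Proof.
have [a [b [a0 ab sub]]] := box_sub_ball2 d0 r0.
pose Q := @box R d a b `*` @box R d a b.
have mQ : measurable Q by exact: measurable_boxes.
have Qoo : (lam Q < +oo)%E by rewrite leb2_boxes ?ltry.
apply: (@lt_le_trans _ _ (a ^+ 2 * fine (lam Q))).
  by rewrite leb2_boxes//= !mulr_gt0 ?exprn_gt0 ?subr_gt0.
have -> : a ^+ 2 * fine (lam Q) = \int[lam]_z (a ^+ 2 * \1_Q z).
  rewrite RintegralZl//; last exact: integrable_indic_fin.
  by rewrite /Rintegral integral_indic// setIT.
apply: Rintegral_mono => //; first by apply: integrableRZ; exact: integrable_indic_fin.
move=> z; rewrite !indicE; have [/set_mem Qz|_] := boolP (z \in Q); last first.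
  by rewrite mulr0 mulr_ge0// dot_ge0.
rewrite mem_set; last exact: sub.
rewrite (_ : true%:R = 1 :> R)// mulr1 mul1r.
apply: le_trans (tnth_sqr_le z.1 (Ordinal d0)).
have [/(_ (Ordinal d0))/andP[h _] _] := Qz.
by rewrite lerXn2r ?nnegrE ?(ltW a0) ?(ltW h)// ltW// (lt_trans a0).
Qed.

Let mS s : measurable (shear s @^-1` B).
Proof. by rewrite -[X in measurable X]setTI; exact: measurable_shear. Qed.

Lemma leb2_shear s : lam (shear s @^-1` B) = lam B.
Proof. by have [_ ->] := shear_preserving (R := R) (d := d) s. Qed.

(* Integrating the test function [M - s x.w] over both sets detects the shear *)
Lemma shear_excess s : s != 0 -> `|s| <= 1 ->
  `|s| * position_moment <= 4 * r ^+ 2 * fine (lam ((shear s @^-1` B) `\` B)).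
Proof.
move=> s0 s1; set O := shear s @^-1` B.
have mO : measurable O by exact: mS.
have Ooo : (lam O < +oo)%E by rewrite leb2_shear.
(* Inside the ball |x.w| <= r^2/2, and a shear with parameter at most 1 adds at most |x|^2 <= r^2.
   Hence |s x.w| <= [M] on both sets, and [f] takes values between 0 and 2 [M] there. *)
pose M := 2 * `|s| * r ^+ 2.
pose f z := M - s * dot z.1 z.2.
have sp : 0 < `|s| by rewrite normr_gt0.
(* A parameter [t] treats both sets at once: t = 0 gives the ball, t = s the sheared ball. *)
have fB t z : `|t| <= 1 -> B z -> 0 <= f (shear (- t) z) <= 2 * M.
  move=> t1 /ball2_originE Bz.
  have E : dot (shear (- t) z).1 (shear (- t) z).2 = dot z.1 z.2 - t * dot z.1 z.1.
    by rewrite dotC dot_shear /= dotC mulNr.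
  have h1 := dot_norm_le z.1 z.2; have p1 := dot_ge0 z.1; have p2 := dot_ge0 z.2.
  have h : `|dot (shear (- t) z).1 (shear (- t) z).2| <= 2 * r ^+ 2.
    rewrite E; apply: le_trans (ler_normB _ _) _.
    have : `|t * dot z.1 z.1| <= dot z.1 z.1 by rewrite normrM (ger0_norm p1) ler_piMl.
    by lra.
  have : `|s * dot (shear (- t) z).1 (shear (- t) z).2| <= M.
    by rewrite normrM /M -mulrA [2 * _]mulrCA ler_wpM2l.
  by rewrite /f ler_norml => /andP[? ?]; apply/andP; split; lra.
have fBB z : B z -> 0 <= f z <= 2 * M.
  by move=> Bz; have := fB 0 z; rewrite normr0 oppr0 shear0; apply.
have fO z : O z -> 0 <= f z <= 2 * M.
  by move=> Oz; have := fB s _ s1 Oz; rewrite shear_cancel ?addNr.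
have ab (a : R) : 0 <= a <= 2 * M -> `|a| <= 2 * M by move=> /andP[a0 ?]; rewrite ger0_norm.
have mf : measurable_fun setT f by apply: measurable_funB => //; exact: measurable_funM.
have iO : lam.-integrable setT (EFin \o (fun z => \1_O z * f z)).
  by apply: (integrable_indic_bounded (c := 2 * M)) => // z /fO/ab.
have iB : lam.-integrable setT (EFin \o (fun z => \1_B z * f z)).
  by apply: (integrable_indic_bounded (c := 2 * M)) => // z /fBB/ab.
have mOB : measurable (O `\` B) by exact: measurableD.
have iOB : lam.-integrable setT (EFin \o (\1_(O `\` B) : R2d -> R)).
  apply: integrable_indic_fin => //; apply: le_lt_trans Ooo.
  by apply: le_measure; rewrite ?inE//; exact: subDsetl.
have e1 : \int[lam]_z (\1_O z * f z) = \int[lam]_z (\1_B z * f z) + s ^+ 2 * position_moment.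
  rewrite -RintegralZl// -RintegralD//; last exact: integrableRZ.
  pose h z := \1_B z * f z + s ^+ 2 * (\1_B z * dot z.1 z.1).
  have mh : measurable_fun setT h.
    by apply: measurable_funD; [|apply: measurable_funM => //]; apply: measurable_funM.
  rewrite -(Rintegral_preserving (shear_preserving s) mh).
  apply: eq_Rintegral => z _; rewrite /h /f (dotC (shear s z).1 (shear s z).2) dot_shear (dotC z.2 z.1).
  rewrite (_ : \1_B (shear s z) = \1_O z)//.
  by rewrite /=; ring.
(* On [O] outside [B] use f <= 2 [M]; on [B] outside [O] drop f >= 0. *)
have e2 : \int[lam]_z (\1_O z * f z) <=
    \int[lam]_z (\1_B z * f z) + 2 * M * fine (lam (O `\` B)).
  have -> : fine (lam (O `\` B)) = \int[lam]_z (\1_(O `\` B) z : R).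
    by rewrite /Rintegral integral_indic// setIT.
  rewrite -RintegralZl// -RintegralD//; last exact: integrableRZ.
  apply: Rintegral_mono => //; first by apply: integrableRD => //; exact: integrableRZ.
  move=> z; rewrite !indicE in_setD.
  have [/set_mem/fO/andP[f1 f2]|nO] := boolP (z \in O).
    by case: (z \in B) => /=; rewrite ?mulr1 ?mulr0 ?mul1r ?mul0r; lra.
  have [/set_mem/fBB/andP[f1 f2]|nB] := boolP (z \in B) => /=.
    by rewrite mulr0 mul0r mul1r addr0.
  by rewrite mulr0 mul0r addr0.
have e3 : s ^+ 2 * position_moment <= 2 * M * fine (lam (O `\` B)).
  by rewrite -(lerD2l (\int[lam]_z (\1_B z * f z))) -e1.
rewrite -(ler_pM2l sp) mulrA -expr2 real_normK ?num_real//.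
apply: le_trans e3 _; rewrite /M le_eqVlt; apply/orP; left; apply/eqP; ring.
Qed.

(** The 8 is the 4 of [shear_excess] times the 2 lost in moving an arbitrary ball to the origin by
    [centered_ball_excess]. Of the symmetric difference only the part of the sheared ball outside
    the competitor is kept. *)
Lemma asymmetry_shear_ge s : s != 0 -> `|s| <= 1 ->
  position_moment / (8 * r ^+ 2 * fine (lam B)) * `|s| <= asymmetry (shear s @^-1` B).
Proof.
move=> s0 s1; set O := shear s @^-1` B.
have mO : measurable O by exact: mS.
have OB : lam O = lam B by exact: leb2_shear.
have v0 : 0 < fine (lam B) by rewrite fine_gt0// ball2_gt0.
apply: lb_le_inf.
  (* A lower bound passes to [inf] only for a nonempty set; the ball itself is a competitor. *)
  exists (fine (lam (O `+` B)) / fine (lam O)), B; last by [].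
  by split; [exists origin, r|rewrite OB].
move=> _ [B' [[c [r' [r'0 ->]]] B'O] <-].
have mB' : measurable (ball2 c r') by exact: measurable_ball2.
have B'B : lam (ball2 origin r') = lam B by rewrite -(leb2_ball2 c) B'O.
have oO z : O (opp2 z) <-> O z by rewrite /O /preimage /= shear_opp2; exact: ball2_opp.
have h1 := same_volume_excess r0 r'0 mO B'B.
have h2 := centered_ball_excess c r' mO oO.
have fin A : measurable A -> (lam (O `\` A) < +oo)%E.
  move=> mA; apply: (@le_lt_trans _ _ (lam O)); last by rewrite OB.
  by apply: le_measure; rewrite ?inE//; exact: measurableD.
have finN A : measurable A -> lam (O `\` A) \is a fin_num by move=> mA; rewrite ge0_fin_numE// fin.
have h3 : fine (lam (O `\` B)) <= 2 * fine (lam (O `\` ball2 c r')).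
  rewrite -lee_fin fineK ?finN// EFinM fineK ?finN//.
  exact: le_trans h1 h2.
have h4 : fine (lam (O `\` ball2 c r')) <= fine (lam (O `+` ball2 c r')).
  have mY : measurable (O `+` ball2 c r').
    by apply: measurableU; exact: measurableD.
  apply: fine_le; [exact: finN| |].
    rewrite ge0_fin_numE//; apply: (@le_lt_trans _ _ (lam (O `|` ball2 c r'))).
      apply: le_measure; rewrite ?inE//; first exact: measurableU.
      by move=> z [[? ?]|[? ?]]; [left|right].
    apply: (@le_lt_trans _ _ (lam O + lam (ball2 c r'))%E); first exact: measureU2.
    by rewrite B'O OB lte_add_pinfty.
  by apply: le_measure; rewrite ?inE//; [exact: measurableD|move=> z; left].
have h5 := shear_excess s0 s1.
rewrite OB ler_pdivlMr//.
have -> : position_moment / (8 * r ^+ 2 * fine (lam B)) * `|s| * fine (lam B) =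
    `|s| * position_moment / (8 * r ^+ 2).
  by field; rewrite !gt_eqF.
rewrite ler_pdivrMr ?mulr_gt0 ?exprn_gt0//.
apply: le_trans h5 _; rewrite -/O.
have r2 : 0 <= r ^+ 2 by exact: sqr_ge0.
apply: (@le_trans _ _ (4 * r ^+ 2 * (2 * fine (lam (O `\` ball2 c r'))))).
  by rewrite ler_wpM2l// mulr_ge0.
rewrite [leRHS]mulrC (_ : 4 * _ * _ = 8 * r ^+ 2 * fine (lam (O `\` ball2 c r'))); last by ring.
by rewrite ler_wpM2l// mulr_ge0.
Qed.

(** Two sets of equal volume have a symmetric difference of at most twice that volume. For negative
    exponents this bounds the power of the asymmetry from below. *)
Lemma asymmetry_shear_le2 s : asymmetry (shear s @^-1` B) <= 2.
Proof.
set O := shear s @^-1` B.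
have mO : measurable O by exact: mS.
have OB : lam O = lam B by exact: leb2_shear.
have v0 : 0 < fine (lam B) by rewrite fine_gt0// ball2_gt0.
apply: (@le_trans _ _ (fine (lam (O `+` B)) / fine (lam O))).
  apply: ge_inf; last first.
    by exists B; last reflexivity; split; [exists origin, r|rewrite OB].
  by exists 0 => _ [B' _ <-]; rewrite divr_ge0// fine_ge0.
rewrite OB ler_pdivrMr// mulr_natl mulr2n.
have mY : measurable (O `+` B) by apply: measurableU; exact: measurableD.
have h : (lam (O `+` B) <= lam B + lam B)%E.
  rewrite -{1}OB; apply: le_trans (measureU2 _ mO mB).
  apply: le_measure; rewrite ?inE//; first exact: measurableU.
  by move=> z [[? ?]|[? ?]]; [left|right].
have fB : lam B \is a fin_num by rewrite ge0_fin_numE.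
rewrite -lee_fin EFinD fineK ?fineK//.
by rewrite ge0_fin_numE//; apply: le_lt_trans h _; rewrite lte_add_pinfty.
Qed.

End Asymmetry.

(** * Contradiction for small shears *)

Lemma powR_le_small {R : realType} (K C p : R) : 0 < K -> 0 < p ->
  exists s : R, [/\ 0 < s, s <= 1 & C * s `^ p < K].
Proof.
(* The witness is t^(1/p), so that its p-th power is t. Then C t <= |C| t < K; the absolute value
   covers either sign of [C], and the added 1 the case C = 0. *)
move=> K0 p0; pose t := Num.min 1 (K / (2 * (`|C| + 1))).
have C1 : 0 < `|C| + 1 by rewrite ltr_wpDl.
have t0 : 0 < t by rewrite lt_min ltr01 divr_gt0// mulr_gt0.
have t1 : t <= 1 by rewrite ge_min lexx.
exists (t `^ p^-1); split.
- exact: powR_gt0.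
- rewrite (_ : 1 = 1 `^ p^-1); last by rewrite powR1.
  by rewrite ge0_ler_powR ?nnegrE ?invr_ge0 ?(ltW p0) ?(ltW t0).
- rewrite -powRrM mulVf ?gt_eqF// powRr1 ?ltW//.
  apply: (@le_lt_trans _ _ (`|C| * t)).
    by rewrite ler_wpM2r ?ler_norm// ltW.
  apply: (@le_lt_trans _ _ (`|C| * (K / (2 * (`|C| + 1))))).
    by rewrite ler_wpM2l// ge_min lexx orbT.
  by rewrite mulrA ltr_pdivrMr ?mulr_gt0//; have := normr_ge0 C; nra.
Qed.

Theorem mainTheorem5 (R : realType) (d : nat) (gamma : R) :
  (1 <= d)%N -> gamma < 2 ->
  ~ exists c1 c2 : R, [/\ 0 < c1, 0 < c2 &
      forall Omega : set (d.-tuple R * d.-tuple R)%type,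
        measurable Omega -> (0 < leb2 Omega)%E -> (leb2 Omega < +oo)%E ->
        0 < asymmetry Omega ->
        (hs_norm2 (leb R d) (loc_op Omega)
         <= hs_norm2 (leb R d) (loc_op (symm_rearr Omega))
            - (c1 * beta d c2 (fine (leb2 Omega))
               * asymmetry Omega `^ gamma)%:E)%E].
Proof.
move=> d0 g2 [c1 [c2 [c10 c20 H]]].
pose V := @leb2 R d (ball2 origin 1).
(* The radius is taken from the very [xget] expression of [symm_rearr], so that the rearrangement of
   each sheared ball rewrites to [B]. The volume [V] of the unit ball makes the set nonempty, with
   witness 1. *)
pose r : R := xget 0 [set r | 0 < r /\ @leb2 R d (ball2 origin r) = V].
have [r0 BV] : 0 < r /\ @leb2 R d (ball2 origin r) = V.
  by apply: (@xgetPex _ 0 [set r | 0 < r /\ @leb2 R d (ball2 origin r) = V]); exists 1.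
pose B := ball2 origin r : set (d.-tuple R * d.-tuple R).
have mB : measurable B by exact: measurable_ball2.
have Boo : (leb2 B < +oo)%E by exact: ball2_fin.
have B0 : (0 < leb2 B)%E by exact: ball2_gt0.
pose v := fine (leb2 B).
have v0 : 0 < v by rewrite fine_gt0// B0 Boo.
have Bv : leb2 B = v%:E by rewrite /v fineK// ge0_fin_numE.
have B_bnd z : B z -> dot z.1 z.1 <= r ^+ 2 by exact: ball2_fst_le.
have [C hC] := hs_deficit_quadratic mB Bv v0 B_bnd.
pose kappa := @position_moment R d r / (8 * r ^+ 2 * v).
have kappa0 : 0 < kappa.
  by rewrite divr_gt0 ?(position_moment_gt0 d0 r0)// !mulr_gt0// exprn_gt0.
pose k := c1 * beta d c2 v.
have k0 : 0 < k.
  rewrite mulr_gt0// /beta; case: ifP => _; first exact: powR_gt0.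
  by rewrite mulr_gt0 ?expR_gt0// exprn_gt0.
have mS s : measurable (shear s @^-1` B).
  by rewrite -[X in measurable X]setTI; exact: measurable_shear.
have Hs s : s != 0 -> `|s| <= 1 ->
  (hs_norm2 (leb R d) (loc_op (shear s @^-1` B)) <= hs_norm2 (leb R d) (loc_op B) -
     (k * asymmetry (shear s @^-1` B) `^ gamma)%:E)%E.
  move=> s0 s1.
  have SB : leb2 (shear s @^-1` B) = leb2 B by exact: leb2_shear.
  have a0 : 0 < asymmetry (shear s @^-1` B).
    apply: lt_le_trans (asymmetry_shear_ge d0 r0 s0 s1).
    by rewrite mulr_gt0 ?normr_gt0.
  have SV : leb2 (shear s @^-1` B) = V by rewrite -BV; exact: SB.
  have RB : symm_rearr (shear s @^-1` B) = B by rewrite /symm_rearr SV.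
  have := H _ (mS s); rewrite SB RB => /(_ B0 Boo a0); exact.
have key s : 0 < s -> s <= 1 -> k * asymmetry (shear s @^-1` B) `^ gamma <= C * s ^+ 2.
  move=> s0 s1.
  have sn : s != 0 by rewrite gt_eqF.
  have sa : `|s| <= 1 by rewrite ger0_norm// ltW.
  have Nn : - s != 0 by rewrite oppr_eq0.
  have Na : `|- s| <= 1 by rewrite normrN.
  apply: le_trans (hC s _ _ sn (Hs _ Nn Na) (Hs _ sn sa)).
  (* Of the two deficits, the one of the opposite shear is nonnegative and is discarded. *)
  by rewrite lerDr mulr_ge0 ?powR_ge0// ltW.
have age s : 0 < s -> s <= 1 -> kappa * s <= asymmetry (shear s @^-1` B).
  move=> s0 s1; have := @asymmetry_shear_ge R d r d0 r0 s.
  by rewrite gt_eqF// ger0_norm ?(ltW s0)//; exact.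
have ale s : asymmetry (shear s @^-1` B) <= 2 by exact: asymmetry_shear_le2.
(* The power is increasing for [gamma] >= 0, where the lower bound kappa s on the asymmetry gives k
   (kappa s)^gamma <= C s^2. For [gamma] < 0 it is decreasing, and the upper bound 2 gives k 2^gamma
   <= C s^2. Both fail for small s. *)
have [g0|g0] := leP 0 gamma.
- have [s [s0 s1 sC]] : exists s : R, [/\ 0 < s, s <= 1 & C * s `^ (2 - gamma) < k * kappa `^ gamma].
    by apply: powR_le_small; [rewrite mulr_gt0// powR_gt0|rewrite subr_gt0].
  have h1 := key s s0 s1.
  have h2 : kappa `^ gamma * s `^ gamma <= asymmetry (shear s @^-1` B) `^ gamma.
    rewrite -powRM ?(ltW kappa0) ?(ltW s0)//.
    have ks := age _ s0 s1.
    have ks0 : 0 <= kappa * s by rewrite mulr_ge0 ?ltW.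
    by rewrite ge0_ler_powR ?nnegrE// (le_trans ks0).
  have sg : 0 < s `^ gamma by exact: powR_gt0.
  (* Cancelling s^gamma leaves C s^(2 - gamma), whose exponent is positive because [gamma] < 2. *)
  have E : s ^+ 2 = s `^ (2 - gamma) * s `^ gamma.
    rewrite -powRD ?subrK ?powR_mulrn ?(ltW s0)//.
    by rewrite gt_eqF// implybT.
  have : k * (kappa `^ gamma * s `^ gamma) <= C * (s `^ (2 - gamma) * s `^ gamma).
    by rewrite -E; apply: le_trans h1; rewrite ler_pM2l.
  by rewrite !mulrA ler_pM2r// leNgt sC.
- have [s [s0 s1 sC]] : exists s : R, [/\ 0 < s, s <= 1 & C * s `^ 2 < k * 2 `^ gamma].
    by apply: powR_le_small; [rewrite mulr_gt0// powR_gt0|].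
  have a0 : 0 < asymmetry (shear s @^-1` B).
    by apply: lt_le_trans (age _ s0 s1); rewrite mulr_gt0.
  have h2 : 2 `^ gamma <= asymmetry (shear s @^-1` B) `^ gamma.
    have E (x : R) : x `^ gamma = (x `^ (- gamma))^-1 by rewrite -powRN opprK.
    rewrite !E lef_pV2 ?posrE ?powR_gt0//.
    apply: ge0_ler_powR; [by rewrite oppr_ge0 ltW|by rewrite nnegrE ltW|by rewrite nnegrE|].
    exact: ale.
  rewrite powR_mulrn ?(ltW s0)// in sC.
  suff : C * s ^+ 2 < k * asymmetry (shear s @^-1` B) `^ gamma by rewrite ltNge (key s s0 s1).
  by apply: lt_le_trans sC _; rewrite ler_pM2l.
Qed.
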